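(* Let $k$ be a field of characteristic $0$ and let $W$ be an $n$-dimensional $k$-vector space. Then the categorical Gelfand--Kirillov dimension of the tensor algebra $T(W)$, regarded as a twisted commutative algebra (a commutative algebra object of $\mathrm{Rep}(\mathfrak{S}_* )$), is $$\mathrm{GKdim}(T(W)) = \binom{n+1}{2}.$$
   Context: $\mathrm{Rep}(\mathfrak{S}_* )$ is the category of sequences $\{V_n\}_{n \in \mathbf{N}}$ with $V_n$ a $k$-representation of the symmetric group $\mathfrak{S}_n$; it is symmetric monoidal with $(V \boxtimes V')_n = \bigoplus_{i=0}^n \mathrm{Ind}_{\mathfrak{S}_i \times \mathfrak{S}_{n-i}}^{\mathfrak{S}_n} (V_i \otimes V'_{n-i})$ and braiding induced from vector spaces. A twisted commutative algebra (tca) is a commutative algebra object in $\mathrm{Rep}(\mathfrak{S}_* )$. The tensor algebra $T(W)$ is a tca with $\mathfrak{S}_n$ acting on $T(W)_n = W^{\otimes n}$ by $\sigma(w_1 \cdots w_n) = w_{\sigma^{-1}(1)} \cdots w_{\sigma^{-1}(n)}$; it is the free tca $\mathrm{Sym}(W\langle 1\rangle)$ on $W$ placed in degree $1$. Categorical Gelfand--Kirillov dimension: let $\mathcal{C}$ be a symmetric monoidal $k$-linear abelian category of Krull--Gabriel dimension zero (every object is locally of finite length), $A$ a finitely generated commutative algebra object in $\mathcal{C}$, and $V \subset A$ a finite length subobject generating $A$ (i.e. the canonical map $\mathrm{Sym}(V) \to A$ is surjective). Let $f_{A;V}(m)$ be the length in $\mathcal{C}$ of the image of the canonical map $\bigoplus_{i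 \le m} \mathrm{Sym}^i(V) \to A$. Then $\dim(A;V)$ is the smallest real number $r$ such that there exists a real number $c$ with $f_{A;V}(m) \le c\, m^r$ for all integers $m \ge 1$, and $\dim(A;V) = \infty$ if no such real number exists. This does not depend on the choice of $V$, and $\mathrm{GKdim}(A) := \dim(A;V)$. *)

(* Defs.v *)
From HB Require Import structures.
From mathcomp Require Import all_boot all_order all_fingroup all_algebra.
From mathcomp Require Import generic_quotient boolp classical_sets reals ereal exp.

Set Implicit Arguments.
Unset Strict Implicit.
Unset Printing Implicit Defensive.

Import Order.TTheory GRing.Theory Num.Theory.
Local Open Scope ring_scope.

HB.lock Definition mklin (k : fieldType) (U V : lmodType k) (f : U -> V)
    (Hf : linear f) : {linear U -> V} :=
  HB.pack f (GRing.isLinear.Build k U V _ f Hf).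

Lemma mklinE (k : fieldType) (U V : lmodType k) (f : U -> V) (Hf : linear f) x :
  mklin Hf x = f x.
Proof. by rewrite mklin.unlock. Qed.

(* The k-module with generators G and relations P: P says which maps b from G
   to a k-module M satisfy the relations.  Elements are formal linear
   combinations of generators; two are identified when every map satisfying the
   relations gives them the same value. *)
Section Presentation.
Context (k : fieldType) (G : Type).
Variable P : forall M : lmodType k, (G -> M) -> Prop.

Definition formal_sum : Type := seq (k * {classic G}).

Definition eval_sum (M : lmodType k) (b : G -> M) (s : formal_sum) : M :=
  \sum_(p <- s) p.1 *: b p.2.

Definition same_sum (s t : formal_sum) : bool :=
  `[< forall (M : lmodType k) (b : G -> M), P b -> eval_sum b s = eval_sum b t >].

Lemma same_sum_refl : reflexive same_sum.
Proof. by move=> s; apply/asboolP. Qed.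
Lemma same_sum_sym : symmetric same_sum.
Proof. by move=> s t; apply/asboolP/asboolP => H M b Pb; rewrite H. Qed.
Lemma same_sum_trans : transitive same_sum.
Proof.
by move=> s t u /asboolP H /asboolP K; apply/asboolP => M b Pb; rewrite H // K.
Qed.
Canonical same_sum_equiv :=
  EquivRel same_sum same_sum_refl same_sum_sym same_sum_trans.

Definition presented := {eq_quot same_sum}%qT.
HB.instance Definition _ := Choice.on presented.

Definition pval (M : lmodType k) (b : G -> M) (x : presented) : M :=
  eval_sum b (repr x).

Definition psum (s : formal_sum) : presented := (\pi_presented s)%qT.

Lemma pval_psum (M : lmodType k) (b : G -> M) (s : formal_sum) :
  P b -> pval b (psum s) = eval_sum b s.
Proof.
move=> Pb; rewrite /pval /psum.
have /eqquotP/asboolP : (\pi_presented (repr (\pi_presented s)) = \pi_presented s)%qT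
  by rewrite reprK.
exact.
Qed.

Lemma presP (x y : presented) :
  (forall (M : lmodType k) (b : G -> M), P b -> pval b x = pval b y) -> x = y.
Proof.
move=> H; rewrite -[x]reprK -[y]reprK; apply/eqquotP/asboolP => M b Pb.
exact: H.
Qed.

Definition padd (x y : presented) := psum (repr x ++ repr y).
Definition pscale (a : k) (x : presented) :=
  psum [seq (a * p.1, p.2) | p <- repr x].
Definition popp (x : presented) := pscale (-1) x.
Definition pzero := psum [::].

Lemma pval_add (M : lmodType k) (b : G -> M) x y : P b -> pval b (padd x y) = pval b x + pval b y.
Proof. by move=> Pb; rewrite pval_psum // /eval_sum big_cat. Qed.
Lemma pval_scale (M : lmodType k) (b : G -> M) a x :
  P b -> pval b (pscale a x) = a *: pval b x.
Proof.
move=> Pb; rewrite pval_psum // /eval_sum big_map scaler_sumr.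
by apply: eq_bigr => p _; rewrite scalerA.
Qed.
Lemma pval_opp (M : lmodType k) (b : G -> M) x : P b -> pval b (popp x) = - pval b x.
Proof. by move=> Pb; rewrite pval_scale // scaleN1r. Qed.
Lemma pval_zero (M : lmodType k) (b : G -> M) : P b -> pval b pzero = 0.
Proof. by move=> Pb; rewrite pval_psum // /eval_sum big_nil. Qed.

Let pE := (pval_add, pval_scale, pval_opp, pval_zero).

Lemma paddA : associative padd.
Proof. by move=> x y z; apply: presP => M b Pb; rewrite !pE // addrA. Qed.
Lemma paddC : commutative padd.
Proof. by move=> x y; apply: presP => M b Pb; rewrite !pE // addrC. Qed.
Lemma padd0 : left_id pzero padd.
Proof. by move=> x; apply: presP => M b Pb; rewrite !pE // add0r. Qed.
Lemma paddN : left_inverse pzero popp padd.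
Proof. by move=> x; apply: presP => M b Pb; rewrite !pE // addNr. Qed.
HB.instance Definition _ := GRing.isZmodule.Build presented paddA paddC padd0 paddN.

Lemma pscaleA a b x : pscale a (pscale b x) = pscale (a * b) x.
Proof. by apply: presP => M c Pc; rewrite !pE // scalerA. Qed.
Lemma pscale1 : left_id 1 pscale.
Proof. by move=> x; apply: presP => M c Pc; rewrite !pE // scale1r. Qed.
Lemma pscaleDr : right_distributive pscale +%R.
Proof. by move=> a x y; apply: presP => M c Pc; rewrite !pE // scalerDr. Qed.
Lemma pscaleDl x : {morph pscale^~ x : a b / a + b}.
Proof. by move=> a b; apply: presP => M c Pc; rewrite !pE // scalerDl. Qed.
HB.instance Definition _ :=
  GRing.Zmodule_isLmodule.Build k presented pscaleA pscale1 pscaleDr pscaleDl.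

Definition gen (g : G) : presented := psum [:: (1, g : {classic G})].

Lemma pval_gen (M : lmodType k) (b : G -> M) g : P b -> pval b (gen g) = b g.
Proof. by move=> Pb; rewrite pval_psum // /eval_sum big_seq1 scale1r. Qed.

Lemma pval_linear (M : lmodType k) (b : G -> M) : P b -> linear (pval b).
Proof. by move=> Pb a x y; rewrite (pval_add _ _ Pb) (pval_scale _ _ Pb). Qed.

Definition plift (M : lmodType k) (b : G -> M) (Pb : P b) : {linear presented -> M} :=
  mklin (pval_linear Pb).

Lemma plift_gen (M : lmodType k) (b : G -> M) (Pb : P b) g : plift Pb (gen g) = b g.
Proof. by rewrite mklinE pval_gen. Qed.

Lemma pval_sum (M : lmodType k) (b : G -> M) I (r : seq I) (F : I -> presented) :
  P b -> pval b (\sum_(i <- r) F i) = \sum_(i <- r) pval b (F i).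
Proof.
move=> Pb; rewrite -(mklinE (pval_linear Pb)) linear_sum.
by apply: eq_bigr => i _; rewrite mklinE.
Qed.

Lemma pres_gen (x : presented) : x = \sum_(p <- repr x) p.1 *: gen p.2.
Proof.
apply: presP => M b Pb; rewrite pval_sum //; apply: eq_bigr => p _.
by rewrite pval_scale // pval_gen.
Qed.

Lemma pres_ind (Q : presented -> Prop) : Q 0 ->
  (forall a g y, Q y -> Q (a *: gen g + y)) -> forall x, Q x.
Proof.
move=> Q0 QD x; rewrite (pres_gen x); elim: (repr x : seq _) => [|p s IH].
  by rewrite big_nil.
by rewrite big_cons; exact: QD.
Qed.

Lemma pres_ext (M : lmodType k) (f h : {linear presented -> M}) :
  (forall g, f (gen g) = h (gen g)) -> forall x, f x = h x.
Proof.
move=> fh; apply: pres_ind => [|a g y IH]; first by rewrite !linear0.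
by rewrite !linearP fh IH.
Qed.

Lemma gen_rel (g h : G) (s : seq (k * G)) :
  (forall (M : lmodType k) (b : G -> M), P b -> b g = \sum_(p <- s) p.1 *: b p.2) ->
  gen g = \sum_(p <- s) p.1 *: gen p.2.
Proof.
move=> H; apply: presP => M b Pb; rewrite pval_gen // H // pval_sum //.
by apply: eq_bigr => p _; rewrite pval_scale // pval_gen.
Qed.
End Presentation.

(* The bijection {0..i-1} + {0..j-1} -> {0..n-1} for i + j = n that puts the
   second block after the first, and its inverse. *)
Definition place i j n (E : (i + j = n)%N) (s : 'I_i + 'I_j) : 'I_n :=
  cast_ord E (unsplit s).
Definition locate i j n (E : (i + j = n)%N) (x : 'I_n) : 'I_i + 'I_j :=
  split (cast_ord (esym E) x).

Lemma placeK i j n (E : (i + j = n)%N) : cancel (place E) (locate E).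
Proof. by move=> s; rewrite /place /locate cast_ordK unsplitK. Qed.
Lemma locateK i j n (E : (i + j = n)%N) : cancel (locate E) (place E).
Proof. by move=> x; rewrite /place /locate splitK cast_ordKV. Qed.

Section Block.
Variables (i j n : nat).

Definition block_fun (E : (i + j = n)%N) (a : 'S_i) (b : 'S_j) (x : 'I_n) : 'I_n :=
  place E (match locate E x with inl y => inl (a y) | inr z => inr (b z) end).
Lemma block_inj E a b : injective (block_fun E a b).
Proof.
apply: (can_inj (g := block_fun E a^-1%g b^-1%g)) => x; rewrite /block_fun placeK.
by case: (locate E x) (locateK E x) => y <-; rewrite permK.
Qed.
(* The image of (a, b) under S_i x S_j -> S_n. *)
Definition block (E : (i + j = n)%N) (a : 'S_i) (b : 'S_j) : 'S_n :=
  perm (@block_inj E a b).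

Definition shuffle_fun (E : (i + j = n)%N) (E' : (j + i = n)%N) (x : 'I_n) : 'I_n :=
  place E (match locate E' x with inl y => inr y | inr z => inl z end).
Lemma shuffle_inj E E' : injective (shuffle_fun E E').
Proof.
move=> x y /(can_inj (placeK E)) H; rewrite -(locateK E' x) -(locateK E' y).
by case: (locate E' x) (locate E' y) H => ? [] ? // [->].
Qed.
(* The permutation x |-> i + x for x < j, and x |-> x - j for x >= j. *)
Definition shuffle (E : (i + j = n)%N) (E' : (j + i = n)%N) : 'S_n :=
  perm (@shuffle_inj E E').

Lemma blockE E a b s : block E a b (place E s) =
  place E (match s with inl y => inl (a y) | inr z => inr (b z) end).
Proof. by rewrite permE /block_fun placeK. Qed.
Lemma shuffleE E E' s : shuffle E E' (place E' s) =
  place E (match s with inl y => inr y | inr z => inl z end).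
Proof. by rewrite permE /shuffle_fun placeK. Qed.
End Block.

Lemma eq_place i j n (E : (i + j = n)%N) (f g : 'S_n) :
  (forall s, f (place E s) = g (place E s)) -> f = g.
Proof. by move=> H; apply/permP => x; rewrite -(locateK E x). Qed.

Lemma val_place i j n (E : (i + j = n)%N) s : val (place E s) =
  match s with inl y => val y | inr z => (i + val z)%N end.
Proof. by case: s. Qed.

Lemma blockM i j n (E : (i + j = n)%N) (a a' : 'S_i) (b b' : 'S_j) :
  block E (a * a')%g (b * b')%g = (block E a b * block E a' b')%g.
Proof. by apply: (eq_place (E := E)) => -[y|z]; rewrite permM !blockE permM. Qed.
Lemma block1 i j n (E : (i + j = n)%N) : block E 1%g 1%g = 1%g.
Proof. by apply: (eq_place (E := E)) => -[y|z]; rewrite blockE !perm1. Qed.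

Section Assoc.
Variables (p q l i j n : nat).
Variables (Ei : (p + q = i)%N) (E : (i + l = n)%N).
Variables (Ej : (q + l = j)%N) (E' : (p + j = n)%N).

Lemma placeA1 x : place E (inl (place Ei (inl x))) = place E' (inl x).
Proof. by apply: val_inj; rewrite !val_place. Qed.
Lemma placeA2 x : place E (inl (place Ei (inr x))) = place E' (inr (place Ej (inl x))).
Proof. by apply: val_inj; rewrite !val_place. Qed.
Lemma placeA3 x : place E (inr x) = place E' (inr (place Ej (inr x))).
Proof. by apply: val_inj; rewrite !val_place -Ei addnA. Qed.

Lemma blockA (a : 'S_p) (b : 'S_q) (c : 'S_l) :
  block E (block Ei a b) c = block E' a (block Ej b c).
Proof.
apply: (eq_place (E := E)) => -[y|z].
  rewrite -(locateK Ei y); case: (locate Ei y) => x.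
    by rewrite blockE blockE !placeA1 blockE.
  by rewrite blockE blockE !placeA2 blockE blockE.
by rewrite blockE !placeA3 blockE blockE.
Qed.
End Assoc.

(* 'S_n composes from left to right: (s * t) x = t (s x).  The composite of
   s after t, as a left action sees it, is therefore t * s. *)
Record symrep (k : fieldType) := SymRep {
  symrep_mod :> nat -> lmodType k;
  act : forall n, 'S_n -> {linear symrep_mod n -> symrep_mod n};
  act1 : forall n x, act (1 : 'S_n)%g x = x;
  actM : forall n (s t : 'S_n) x, act (t * s)%g x = act s (act t x) }.
Arguments act {k _ n} _ : rename, simpl never.

Record symhom (k : fieldType) (X Y : symrep k) := SymHom {
  symhom_fun :> forall n, {linear X n -> Y n};
  symhom_act : forall n (s : 'S_n) x, symhom_fun n (act s x) = act s (symhom_fun n x) }.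

Definition eqhom (k : fieldType) (X Y : symrep k) (f g : symhom X Y) : Prop :=
  forall n x, f n x = g n x.

Section Category.
Context (k : fieldType).

Definition idhom (X : symrep k) : symhom X X :=
  @SymHom k X X (fun n => idfun) (fun n s x => erefl).

Lemma comphom_act (X Y Z : symrep k) (g : symhom Y Z) (f : symhom X Y) n (s : 'S_n) x :
  (g n \o f n) (act s x) = act s ((g n \o f n) x).
Proof. by rewrite /= !symhom_act. Qed.
Definition comphom (X Y Z : symrep k) (g : symhom Y Z) (f : symhom X Y) : symhom X Z :=
  @SymHom k X Z (fun n => (g n \o f n : {linear X n -> Z n})) (comphom_act g f).

Record subrep (X : symrep k) := SubRep {
  subrep_set :> forall n, set (X n);
  subrep0 : forall n, @subrep_set n 0;
  subrepP : forall n a (x y : X n), @subrep_set n x -> @subrep_set n y ->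
    @subrep_set n (a *: x + y);
  subrep_act : forall n (s : 'S_n) x, @subrep_set n x -> @subrep_set n (act s x) }.
Arguments subrep_set {X} _ n _.

Definition subrep_le (X : symrep k) (U V : subrep X) : Prop :=
  forall n x, U n x -> V n x.

(* U is strictly contained in V, and V / U is simple. *)
Definition subrep_max (X : symrep k) (U V : subrep X) : Prop :=
  [/\ subrep_le U V, ~ subrep_le V U &
      forall Z, subrep_le U Z -> subrep_le Z V -> subrep_le Z U \/ subrep_le V Z].

(* The subobject U, as an object, has length l: it has a composition series
   with l factors. *)
Definition has_length (X : symrep k) (U : subrep X) (l : nat) : Prop :=
  exists c : nat -> subrep X,
    [/\ forall n x, c 0%N n x -> x = 0,
        subrep_le (c l) U /\ subrep_le U (c l) &
        forall i, (i < l)%N -> subrep_max (c i) (c i.+1)].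

Lemma fullrep_act (X : symrep k) n (s : 'S_n) (x : X n) : setT x -> setT (act s x).
Proof. by []. Qed.
Definition fullrep (X : symrep k) : subrep X :=
  @SubRep X (fun n => setT) (fun n => I) (fun n a x y _ _ => I) (@fullrep_act X).

Definition finite_length (X : symrep k) : Prop := exists l, has_length (fullrep X) l.

End Category.

Section Day.
Context (k : fieldType).
Implicit Types (X Y Z : symrep k).

(* Degree n of the product of X and Y is the direct sum over i + j = n of
   Ind_{S_i x S_j}^{S_n} (X_i (x) Y_j) = k[S_n] (x)_{k[S_i x S_j]} (X_i (x) Y_j).
   It is generated by the g (x * y), with g in S_n, x in X_i and y in Y_j, which
   are bilinear in (x, y) and satisfy (g (s, t)) (x * y) = g ((s x) * (t y)). *)
Record day_gen X Y (n : nat) := DayGen {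
  dg_i : nat; dg_j : nat; dg_eq : (dg_i + dg_j = n)%N;
  dg_perm : 'S_n; dg_l : X dg_i; dg_r : Y dg_j }.
Arguments DayGen {X Y n i j} _ _ _ _ : rename.

Record balanced X Y n (M : lmodType k) (b : day_gen X Y n -> M) : Prop := Balanced {
  balancedL : forall i j (E : (i + j = n)%N) g y,
    linear (fun x : X i => b (DayGen E g x y));
  balancedR : forall i j (E : (i + j = n)%N) g x,
    linear (fun y : Y j => b (DayGen E g x y));
  balancedS : forall i j (E : (i + j = n)%N) g (s : 'S_i) (t : 'S_j) (x : X i) (y : Y j),
    b (DayGen E (block E s t * g)%g x y) = b (DayGen E g (act s x) (act t y)) }.

Definition day_mod X Y n : lmodType k := presented (@balanced X Y n).

Definition pt X Y n i j (E : (i + j = n)%N) (g : 'S_n) (x : X i) (y : Y j) :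
  day_mod X Y n := gen (@balanced X Y n) (DayGen E g x y).

Lemma ptL X Y n i j (E : (i + j = n)%N) g (y : Y j) : linear (fun x : X i => pt E g x y).
Proof.
move=> a x x'; apply: presP => M b Pb; rewrite (pval_linear Pb) !pval_gen //.
exact: (balancedL Pb).
Qed.
Lemma ptR X Y n i j (E : (i + j = n)%N) g (x : X i) : linear (fun y : Y j => pt E g x y).
Proof.
move=> a y y'; apply: presP => M b Pb; rewrite (pval_linear Pb) !pval_gen //.
exact: (balancedR Pb).
Qed.
Lemma ptS X Y n i j (E : (i + j = n)%N) g (s : 'S_i) (t : 'S_j) (x : X i) (y : Y j) :
  pt E (block E s t * g)%g x y = pt E g (act s x) (act t y).
Proof. by apply: presP => M b Pb; rewrite !pval_gen //; exact: (balancedS Pb). Qed.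
Lemma pt0 X Y n i j (E : (i + j = n)%N) g (y : Y j) : pt E g (0 : X i) y = 0.
Proof. by rewrite -(mklinE (ptL E g y)) linear0. Qed.
Lemma pt0r X Y n i j (E : (i + j = n)%N) g (x : X i) : pt E g x (0 : Y j) = 0.
Proof. by rewrite -(mklinE (ptR E g x)) linear0. Qed.

Definition day_lift X Y n (M : lmodType k) (b : day_gen X Y n -> M) (Pb : balanced b) :
  {linear day_mod X Y n -> M} := plift Pb.
Lemma day_liftE X Y n (M : lmodType k) (b : day_gen X Y n -> M) (Pb : balanced b)
  i j (E : (i + j = n)%N) g (x : X i) (y : Y j) :
  day_lift Pb (pt E g x y) = b (DayGen E g x y).
Proof. exact: plift_gen. Qed.

Lemma day_ext X Y n (M : lmodType k) (f h : day_mod X Y n -> M) :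
  linear f -> linear h ->
  (forall i j (E : (i + j = n)%N) g (x : X i) (y : Y j), f (pt E g x y) = h (pt E g x y)) ->
  forall u, f u = h u.
Proof.
move=> Lf Lh fh u; rewrite -(mklinE Lf) -(mklinE Lh).
by apply: pres_ext => -[i j E g x y]; rewrite !mklinE; exact: fh.
Qed.

Lemma day_ind X Y n (Q : day_mod X Y n -> Prop) : Q 0 ->
  (forall a i j (E : (i + j = n)%N) g (x : X i) (y : Y j) u,
     Q u -> Q (a *: pt E g x y + u)) -> forall u, Q u.
Proof. by move=> Q0 QD; apply: pres_ind => // a [i j E g x y] u Qu; exact: QD. Qed.

Definition day_act_gen X Y n (s : 'S_n) (w : day_gen X Y n) : day_mod X Y n :=
  let: DayGen i j E g x y := w in pt E (g * s)%g x y.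
Lemma day_act_bal X Y n (s : 'S_n) : balanced (@day_act_gen X Y n s).
Proof.
split=> *; [exact: ptL|exact: ptR|].
by rewrite /day_act_gen -mulgA ptS.
Qed.
Definition day_act X Y n (s : 'S_n) : {linear day_mod X Y n -> day_mod X Y n} :=
  day_lift (@day_act_bal X Y n s).

Lemma day_actE X Y n (s : 'S_n) i j (E : (i + j = n)%N) g (x : X i) (y : Y j) :
  day_act X Y s (pt E g x y) = pt E (g * s)%g x y.
Proof. exact: day_liftE. Qed.

Lemma day_act1 X Y n x : day_act X Y (1 : 'S_n)%g x = x.
Proof.
move: x; apply: day_ext => [||i j E g x y]; [exact: linearP|by []|].
by rewrite day_actE mulg1.
Qed.
Lemma day_actM X Y n (s t : 'S_n) x :
  day_act X Y (t * s)%g x = day_act X Y s (day_act X Y t x).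
Proof.
move: x; apply: day_ext => [|a x y|i j E g x y]; [exact: linearP|by rewrite !linearP|].
by rewrite !day_actE mulgA.
Qed.

Definition day X Y : symrep k := SymRep (@day_act1 X Y) (@day_actM X Y).

Lemma act_pt X Y n (s : 'S_n) i j (E : (i + j = n)%N) g (x : X i) (y : Y j) :
  @act _ (day X Y) n s (pt E g x y) = pt E (g * s)%g x y.
Proof. exact: day_actE. Qed.

Lemma lin_comb (U M : lmodType k) (a : k) (f h : U -> M) :
  linear f -> linear h -> linear (fun u => a *: f u + h u).
Proof.
move=> Lf Lh c u v; rewrite Lf Lh !scalerDr !scalerA mulrC -!addrA.
by congr (_ + _); rewrite addrCA.
Qed.

Section DayHom.
Context (X X' Y Y' : symrep k) (f : symhom X X') (g : symhom Y Y').

Definition dayhom_gen n (w : day_gen X Y n) : day X' Y' n :=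
  let: DayGen i j E s x y := w in pt E s (f i x) (g j y).
Lemma dayhom_bal n : balanced (@dayhom_gen n).
Proof.
split=> [i j E s y a x x'|i j E s x a y y'|i j E s u v x y] /=.
- by rewrite linearP ptL.
- by rewrite linearP ptR.
- by rewrite ptS !symhom_act.
Qed.
Definition dayhom_fun n : {linear day X Y n -> day X' Y' n} := day_lift (@dayhom_bal n).
Lemma dayhom_act n (s : 'S_n) (u : day X Y n) :
  dayhom_fun n (act s u) = act s (dayhom_fun n u).
Proof.
move: u; apply: day_ext => [a x y|a x y|i j E r x y]; rewrite ?linearP //.
by rewrite act_pt !day_liftE.
Qed.
Definition dayhom : symhom (day X Y) (day X' Y') := SymHom dayhom_act.

Lemma dayhomE n i j (E : (i + j = n)%N) s (x : X i) (y : Y j) :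
  dayhom n (pt E s x y) = pt E s (f i x) (g j y).
Proof. exact: day_liftE. Qed.
End DayHom.

(* Associativity sends g ((h (x * y)) * z) to g (h, 1) (x * (y * z)). *)
Section DayAssoc.
Context (X Y Z : symrep k).

Lemma assoc_eq p q l i n : (p + q = i)%N -> (i + l = n)%N -> (p + (q + l) = n)%N.
Proof. by move=> <- <-; rewrite addnA. Qed.
Lemma assoc_inv_eq p q l j n : (q + l = j)%N -> (p + j = n)%N -> (p + q + l = n)%N.
Proof. by move=> <- <-; rewrite addnA. Qed.

Definition assoc_gen2 n i l (E : (i + l = n)%N) (g : 'S_n) (z : Z l)
    (w : day_gen X Y i) : day X (day Y Z) n :=
  let: DayGen p q Ei h x y := w in
  pt (assoc_eq Ei E) (block E h 1 * g)%g x
    (pt (erefl (q + l)%N) 1%g y z : day Y Z (q + l)).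
Lemma assoc_bal2 n i l (E : (i + l = n)%N) (g : 'S_n) (z : Z l) :
  balanced (assoc_gen2 E g z).
Proof.
split=> [p q Ei h y a x x'|p q Ei h x a y y'|p q Ei h s t x y] /=.
- exact: ptL.
- by rewrite ptL ptR.
- have -> : block E (block Ei s t * h)%g (1 : 'S_l)%g =
      (block (assoc_eq Ei E) s (block (erefl (q + l)%N) t 1) * block E h 1)%g.
    by rewrite -(blockA Ei E) -blockM mulg1.
  by rewrite -mulgA ptS act_pt mul1g -[in LHS](mulg1 (block _ t _)) ptS act1.
Qed.
Definition assoc_gen n (w : day_gen (day X Y) Z n) : day X (day Y Z) n :=
  let: DayGen i l E g u z := w in day_lift (assoc_bal2 E g z) u.
Lemma assoc_bal n : balanced (@assoc_gen n).
Proof.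
split=> [i l E g z a u u'|i l E g u a z z'|i l E g s t u z]; rewrite /assoc_gen.
- exact: linearP.
- move: u; apply: day_ext => [a' x y||p q Ei h x y]; first by rewrite linearP.
    by apply: lin_comb => a' x y; rewrite linearP.
  by rewrite !day_liftE /= ptR ptR.
- move: u; apply: day_ext => [a' x y|a' x y|p q Ei h x y]; rewrite ?linearP //.
  rewrite act_pt !day_liftE /= mulgA -blockM mul1g.
  have -> : block E (h * s)%g t =
      (block (assoc_eq Ei E) 1 (block (erefl (q + l)%N) 1 t) * block E (h * s)%g 1)%g.
    by rewrite -(blockA Ei E) -blockM block1 mul1g mulg1.
  by rewrite -mulgA ptS act1 act_pt mul1g -[in LHS](mulg1 (block _ 1 t)) ptS act1.
Qed.
Definition assoc_fun n : {linear day (day X Y) Z n -> day X (day Y Z) n} :=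
  day_lift (@assoc_bal n).
Lemma assoc_act n (s : 'S_n) u : assoc_fun n (act s u) = act s (assoc_fun n u).
Proof.
move: u; apply: day_ext => [a x y|a x y|i l E g u z]; rewrite ?linearP //.
rewrite act_pt !day_liftE /assoc_gen.
move: u; apply: day_ext => [a x y|a x y|p q Ei h x y]; rewrite ?linearP //.
by rewrite !day_liftE /= ?act_pt mulgA.
Qed.
Definition assoc : symhom (day (day X Y) Z) (day X (day Y Z)) := SymHom assoc_act.

Definition assoc_inv_gen2 n p j (E : (p + j = n)%N) (g : 'S_n) (x : X p)
    (w : day_gen Y Z j) : day (day X Y) Z n :=
  let: DayGen q l Ej h y z := w in
  pt (assoc_inv_eq Ej E) (block E 1 h * g)%g 
    (pt (erefl (p + q)%N) 1%g x y : day X Y (p + q)) z.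
Lemma assoc_inv_bal2 n p j (E : (p + j = n)%N) (g : 'S_n) (x : X p) :
  balanced (assoc_inv_gen2 E g x).
Proof.
split=> [q l Ej h z a y y'|q l Ej h y a z z'|q l Ej h s t y z] /=.
- by rewrite ptR ptL.
- exact: ptR.
- have -> : block E (1 : 'S_p)%g (block Ej s t * h)%g =
      (block (assoc_inv_eq Ej E) (block (erefl (p + q)%N) 1 s) t * block E 1 h)%g.
    by rewrite (blockA _ _ Ej E) -blockM mulg1.
  by rewrite -mulgA ptS act_pt mul1g -[in LHS](mulg1 (block _ _ s)) ptS act1.
Qed.
Definition assoc_inv_gen n (w : day_gen X (day Y Z) n) : day (day X Y) Z n :=
  let: DayGen p j E g x u := w in day_lift (assoc_inv_bal2 E g x) u.
Lemma assoc_inv_bal n : balanced (@assoc_inv_gen n).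
Proof.
split=> [p j E g u a x x'|p j E g x a u u'|p j E g s t x u]; rewrite /assoc_inv_gen.
- move: u; apply: day_ext => [a' y z||q l Ej h y z]; first by rewrite linearP.
    by apply: lin_comb => a' y z; rewrite linearP.
  by rewrite !day_liftE /= ptL ptL.
- exact: linearP.
- move: u; apply: day_ext => [a' y z|a' y z|q l Ej h y z]; rewrite ?linearP //.
  rewrite act_pt !day_liftE /= mulgA -blockM mul1g.
  have -> : block E s (h * t)%g =
      (block (assoc_inv_eq Ej E) (block (erefl (p + q)%N) s 1) 1 * block E 1 (h * t)%g)%g.
    by rewrite (blockA _ _ Ej E) -blockM block1 mul1g mulg1.
  by rewrite -mulgA ptS act1 act_pt mul1g -[in LHS](mulg1 (block _ s 1)) ptS act1.
Qed.
Definition assoc_inv_fun n : {linear day X (day Y Z) n -> day (day X Y) Z n} :=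
  day_lift (@assoc_inv_bal n).
Lemma assoc_inv_act n (s : 'S_n) u :
  assoc_inv_fun n (act s u) = act s (assoc_inv_fun n u).
Proof.
move: u; apply: day_ext => [a x y|a x y|p j E g x u]; rewrite ?linearP //.
rewrite act_pt !day_liftE /assoc_inv_gen.
move: u; apply: day_ext => [a y z|a y z|q l Ej h y z]; rewrite ?linearP //.
by rewrite !day_liftE /= ?act_pt mulgA.
Qed.
Definition assoc_inv : symhom (day X (day Y Z)) (day (day X Y) Z) :=
  SymHom assoc_inv_act.

Lemma assocE n i l p q (E : (i + l = n)%N) (Ei : (p + q = i)%N) g h
    (x : X p) (y : Y q) (z : Z l) :
  assoc n (pt E g (pt Ei h x y : day X Y i) z) =
  pt (assoc_eq Ei E) (block E h 1 * g)%g x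
    (pt (erefl (q + l)%N) 1%g y z : day Y Z (q + l)).
Proof. exact: etrans (day_liftE _ _ _ _ _) (day_liftE (assoc_bal2 E g z) _ _ _ _). Qed.
Lemma assoc_invE n p j q l (E : (p + j = n)%N) (Ej : (q + l = j)%N) g h
    (x : X p) (y : Y q) (z : Z l) :
  assoc_inv n (pt E g x (pt Ej h y z : day Y Z j)) =
  pt (assoc_inv_eq Ej E) (block E 1 h * g)%g
    (pt (erefl (p + q)%N) 1%g x y : day X Y (p + q)) z.
Proof. exact: etrans (day_liftE _ _ _ _ _) (day_liftE (assoc_inv_bal2 E g x) _ _ _ _). Qed.

Lemma assocK : eqhom (comphom assoc_inv assoc) (idhom (day (day X Y) Z)).
Proof.
move=> n; apply: day_ext => [a x y|a x y|i l E g u z]; rewrite ?linearP //.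
move: u; apply: day_ext => [a x y|a x y|p q Ei h x y]; rewrite ?ptL ?linearP //.
rewrite -[LHS]/(assoc_inv n (assoc n _)) assocE assoc_invE block1 mul1g.
case: i / Ei E h => E h; rewrite (eq_irrelevance (assoc_inv_eq _ _) E).
by rewrite ptS act1 act_pt mul1g.
Qed.
Lemma assoc_invK : eqhom (comphom assoc assoc_inv) (idhom (day X (day Y Z))).
Proof.
move=> n; apply: day_ext => [a x y|a x y|p j E g x u]; rewrite ?linearP //.
move: u; apply: day_ext => [a y z|a y z|q l Ej h y z]; rewrite ?ptR ?linearP //.
rewrite -[LHS]/(assoc n (assoc_inv n _)) assoc_invE assocE block1 mul1g.
case: j / Ej E h => E h; rewrite (eq_irrelevance (assoc_eq _ _) E).
by rewrite ptS act1 act_pt mul1g.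
Qed.
End DayAssoc.

(* Symmetry: g (x * y) is sent to (g t) (y * x), t being the permutation that
   puts the block of y behind the block of x. *)
Section DayBraid.
Context (X Y : symrep k).

Lemma braid_eq i j n : (i + j = n)%N -> (j + i = n)%N.
Proof. by rewrite addnC. Qed.
Definition braid_gen n (w : day_gen X Y n) : day Y X n :=
  let: DayGen i j E g x y := w in pt (braid_eq E) (shuffle E (braid_eq E) * g)%g y x.
Lemma braid_bal n : balanced (@braid_gen n).
Proof.
split=> [i j E g y a x x'|i j E g x a y y'|i j E g s t x y] /=.
- exact: ptR.
- exact: ptL.
- rewrite -ptS !mulgA; congr pt; congr (_ * _)%g.
  by apply: (eq_place (E := braid_eq E)) => -[z|z]; rewrite !permM shuffleE blockE blockE shuffleE.
Qed.
Definition braid_fun n : {linear day X Y n -> day Y X n} := day_lift (@braid_bal n).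
Lemma braid_act n (s : 'S_n) u : braid_fun n (act s u) = act s (braid_fun n u).
Proof.
move: u; apply: day_ext => [a x y|a x y|i j E g x y]; rewrite ?linearP //.
by rewrite act_pt !day_liftE /= ?act_pt mulgA.
Qed.
Definition braid : symhom (day X Y) (day Y X) := SymHom braid_act.
Lemma braidE n i j (E : (i + j = n)%N) g (x : X i) (y : Y j) :
  braid n (pt E g x y) = pt (braid_eq E) (shuffle E (braid_eq E) * g)%g y x.
Proof. exact: day_liftE. Qed.
End DayBraid.

(* The unit object: k in degree 0. *)
Definition unit_mod (n : nat) : lmodType k := if n is 0%N then k^o else 'rV[k]_0.
Definition unit_rep : symrep k :=
  @SymRep k unit_mod (fun n _ => idfun) (fun n x => erefl) (fun n s t x => erefl).

Definition rep_cast X m n (E : m = n) (x : X m) : X n := eq_rect m (fun d => X d) x n E.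

Section LeftUnit.
Context (X : symrep k).
Definition lunit_gen n (w : day_gen unit_rep X n) : X n :=
  let: DayGen i j E g c x := w in
  (if i is 0%N return (i + j = n)%N -> unit_mod i -> X n
   then fun E c => c *: act g (rep_cast E x) else fun _ _ => 0) E c.
Lemma lunit_bal n : balanced (@lunit_gen n).
Proof.
split=> [[|i] j E g y a x x'|[|i] j E g x a y y'|[|i] j E g s t x y] //=.
- by rewrite scalerDl scalerA.
- by rewrite scaler0 addr0.
- case: n / E g => g /=.
  by rewrite linearP scalerDr !scalerA mulrC.
- by rewrite scaler0 addr0.
- case: n / E g => g /=; rewrite actM; congr (_ *: act g (act _ y)).
  apply/permP => z.
  have -> : z = place (erefl (0 + j)%N) (inr z) by apply: val_inj.
  by rewrite blockE; apply: val_inj; rewrite /= ; congr (val (t _)); apply: val_inj.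
Qed.
Definition lunit_fun n : {linear day unit_rep X n -> X n} := day_lift (@lunit_bal n).
Lemma lunit_act n (s : 'S_n) u : lunit_fun n (act s u) = act s (lunit_fun n u).
Proof.
move: u; apply: day_ext => [a x y|a x y|i j E g c x]; rewrite ?linearP //.
rewrite act_pt !day_liftE; case: i E c => [|i] E c /=; last by rewrite linear0.
by rewrite actM linearZ.
Qed.
Definition lunit : symhom (day unit_rep X) X := SymHom lunit_act.
End LeftUnit.

(* By commutativity the left unit law implies the right one. *)
Record tca := Tca {
  tca_rep :> symrep k;
  tca_mul : symhom (day tca_rep tca_rep) tca_rep;
  tca_unit : symhom unit_rep tca_rep;
  tca_mulA : eqhom (comphom tca_mul (dayhom tca_mul (idhom tca_rep)))
    (comphom tca_mul (comphom (dayhom (idhom tca_rep) tca_mul)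
      (assoc tca_rep tca_rep tca_rep)));
  tca_mul1 : eqhom (comphom tca_mul (dayhom tca_unit (idhom tca_rep))) (lunit tca_rep);
  tca_mulC : eqhom (comphom tca_mul (braid tca_rep tca_rep)) tca_mul }.

Fixpoint tpow (V : symrep k) (i : nat) : symrep k :=
  if i is i'.+1 then day V (tpow V i') else unit_rep.

(* The symmetry exchanging the factors j and j + 1 (counted from 0) of the i
   factors of tpow V i, when j + 1 < i. *)
Fixpoint swap (V : symrep k) (i j : nat) : symhom (tpow V i) (tpow V i) :=
  match i with
  | 0 => idhom unit_rep
  | i'.+1 =>
    match j with
    | j'.+1 => dayhom (idhom V) (swap V i' j')
    | 0 =>
      match i' return symhom (day V (tpow V i')) (day V (tpow V i')) with
      | 0 => idhom _
      | i''.+1 => comphom (assoc V V (tpow V i''))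
          (comphom (dayhom (braid V V) (idhom (tpow V i'')))
            (assoc_inv V V (tpow V i'')))
      end
    end
  end.

Section SymPower.
Context (V : symrep k) (i : nat).

(* Sym^i(V) is the module of coinvariants of S_i in the i-th tensor power of V;
   S_i is generated by the transpositions of adjacent factors. *)
Record sym_invariant n (M : lmodType k) (b : tpow V i n -> M) : Prop := SymInvariant {
  sym_invariantL : linear b;
  sym_invariantS : forall j u, b (swap V i j n u) = b u }.

Definition sym_mod n : lmodType k := presented (@sym_invariant n).
Definition sym_proj_fun n (u : tpow V i n) : sym_mod n := gen (@sym_invariant n) u.

Lemma sym_projL n : linear (@sym_proj_fun n).
Proof.
move=> a x y; apply: presP => M b Pb; rewrite (pval_linear Pb) !pval_gen //.
exact: (sym_invariantL Pb).
Qed.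
Lemma sym_projS n j u : sym_proj_fun (swap V i j n u) = sym_proj_fun u.
Proof.
by apply: presP => M b Pb; rewrite !pval_gen //; exact: (sym_invariantS Pb).
Qed.

Lemma sym_act_inv n (s : 'S_n) :
  sym_invariant (fun u : tpow V i n => sym_proj_fun (act s u)).
Proof.
split=> [a x y|j u]; first by rewrite linearP sym_projL.
by rewrite -symhom_act sym_projS.
Qed.
Definition sym_act n (s : 'S_n) : {linear sym_mod n -> sym_mod n} :=
  plift (@sym_act_inv n s).
Lemma sym_actE n (s : 'S_n) u : sym_act s (sym_proj_fun u) = sym_proj_fun (act s u).
Proof. exact: plift_gen. Qed.
Lemma sym_act1 n x : sym_act (1 : 'S_n)%g x = x.
Proof.
move: x; apply: (pres_ext (f := sym_act 1%g) (h := idfun)) => u.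
by rewrite [LHS]sym_actE act1.
Qed.
Lemma sym_actM n (s t : 'S_n) x : sym_act (t * s)%g x = sym_act s (sym_act t x).
Proof.
move: x; apply: (pres_ext (f := sym_act (t * s)%g) (h := sym_act s \o sym_act t)) => u.
rewrite [LHS]sym_actE -[RHS]/(sym_act s (sym_act t (sym_proj_fun u))).
by rewrite !sym_actE actM.
Qed.
Definition sym : symrep k := SymRep sym_act1 sym_actM.

Lemma sym_proj_act n (s : 'S_n) u :
  mklin (@sym_projL n) (act s u) = act (s : 'S_n) (mklin (@sym_projL n) u : sym n).
Proof. by rewrite !(mklinE (@sym_projL n)) [RHS]sym_actE. Qed.
Definition sym_proj : symhom (tpow V i) sym :=
  @SymHom k (tpow V i) sym (fun n => mklin (@sym_projL n)) sym_proj_act.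

Lemma sym_ext n (M : lmodType k) (f h : sym n -> M) : linear f -> linear h ->
  (forall u, f (sym_proj n u) = h (sym_proj n u)) -> forall u, f u = h u.
Proof.
move=> Lf Lh fh u; rewrite -(mklinE Lf) -(mklinE Lh).
by apply: pres_ext => v; rewrite !mklinE; have := fh v; rewrite !mklinE.
Qed.
End SymPower.

(* The canonical map Sym^i(V) -> A extending f : V -> A *)
Section CanonicalMap.
Context (A : tca) (V : symrep k) (f : symhom V A).

Fixpoint tpow_map (i : nat) : symhom (tpow V i) A :=
  if i is i'.+1 then comphom (tca_mul A) (dayhom f (tpow_map i')) else tca_unit A.

Let mul n i j (E : (i + j = n)%N) g (x : A i) (y : A j) : A n :=
  tca_mul A n (pt E g x y).

Let mulA n i l p q (E : (i + l = n)%N) (Ei : (p + q = i)%N) g h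
    (x : A p) (y : A q) (z : A l) :
  mul E g (mul Ei h x y) z =
  mul (assoc_eq Ei E) (block E h 1 * g)%g x (mul (erefl (q + l)%N) 1%g y z).
Proof.
have := @tca_mulA A n (pt E g (pt Ei h x y : day A A i) z).
rewrite -[X in X = _ -> _]/(tca_mul A n (dayhom (tca_mul A) (idhom A) n _)).
rewrite -[X in _ = X -> _]/(tca_mul A n (dayhom (idhom A) (tca_mul A) n (assoc A A A n _))).
by rewrite assocE !dayhomE.
Qed.

Let mulC n i j (E : (i + j = n)%N) g (x : A i) (y : A j) :
  mul (braid_eq E) (shuffle E (braid_eq E) * g)%g y x = mul E g x y.
Proof.
have := @tca_mulC A n (pt E g x y).
by rewrite -[X in X = _ -> _]/(tca_mul A n (braid A A n _)) braidE.
Qed.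

Let mapS i n p q (E : (p + q = n)%N) g (x : V p) (u : tpow V i q) :
  tpow_map i.+1 n (pt E g x u) = mul E g (f p x) (tpow_map i q u).
Proof. by rewrite -[LHS]/(tca_mul A n (dayhom f (tpow_map i) n _)) dayhomE. Qed.

Let mulS n i j (E : (i + j = n)%N) g (s : 'S_i) (t : 'S_j) (x : A i) (y : A j) :
  mul E (block E s t * g)%g x y = mul E g (act s x) (act t y).
Proof. by rewrite /mul ptS. Qed.

Let act_mul n i j (E : (i + j = n)%N) g (s : 'S_n) (x : A i) (y : A j) :
  act s (mul E g x y) = mul E (g * s)%g x y.
Proof. by rewrite /mul -symhom_act act_pt. Qed.

Lemma tpow_map_swap i j n u : tpow_map i n (swap V i j n u) = tpow_map i n u.
Proof.
elim: i j n u => [|i IH] [|j] n u //.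
- case: i IH u => [|i] _ u //.
  move: u; apply: day_ext => [a x y|a x y|p r E g x u]; rewrite ?linearP //.
  move: u; apply: day_ext => [a u v|a u v|q l Ej h y z].
  + by rewrite ptR !linearP.
  + by rewrite ptR !linearP.
  case: r / Ej E h => E h.
  rewrite -[swap _ _ _ _ _]/(assoc V V (tpow V i) n
    (dayhom (braid V V) (idhom (tpow V i)) n (assoc_inv V V (tpow V i) n _))).
  rewrite assoc_invE dayhomE braidE assocE !mapS -mulA mulC mulA block1 mul1g.
  rewrite (eq_irrelevance (assoc_eq _ _) E) mulS act1 act_mul mul1g.
  by [].
- move: u; apply: day_ext => [a x y|a x y|p r E g x u]; rewrite ?linearP //.
  rewrite -[swap _ _ _ _ _]/(dayhom (idhom V) (swap V i j) n _) dayhomE !mapS.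
  by rewrite IH.
Qed.

Lemma canon_inv i n : sym_invariant (tpow_map i n).
Proof. by split=> [a x y|j u]; [rewrite linearP|exact: tpow_map_swap]. Qed.
Definition canon_fun i n : {linear sym V i n -> A n} := plift (@canon_inv i n).
Lemma canon_act i n (s : 'S_n) u : canon_fun i n (act s u) = act s (canon_fun i n u).
Proof.
move: u; apply: sym_ext => [a x y|a x y|u]; rewrite ?linearP //.
rewrite -symhom_act !(mklinE (@sym_projL _ _ n)) !(plift_gen (@canon_inv i n)).
by rewrite symhom_act.
Qed.
Definition canon i : symhom (sym V i) A := SymHom (@canon_act i).
Lemma canonE i n u : canon i n (sym_proj V i n u) = tpow_map i n u.
Proof.
by rewrite -[LHS]/(canon_fun i n _) (mklinE (@sym_projL _ _ n)) (plift_gen (@canon_inv i n)).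
Qed.

End CanonicalMap.

Definition mono (X Y : symrep k) (f : symhom X Y) : Prop := forall n, injective (f n).

Section Growth.
Context (A : tca) (V : symrep k) (f : symhom V A).

(* The map from the direct sum of the Sym^i(V), i <= m, to A *)
Definition canon_le (m n : nat) (u : forall i : 'I_m.+1, sym V i n) : A n :=
  \sum_(i < m.+1) canon f i n (u i).

Lemma canon_le0 m n : range (@canon_le m n) 0.
Proof. by exists (fun i => 0) => //; apply: big1 => i _; rewrite linear0. Qed.
Lemma canon_leP m n a x y :
  range (@canon_le m n) x -> range (@canon_le m n) y -> range (@canon_le m n) (a *: x + y).
Proof.
move=> [u _ <-] [v _ <-]; exists (fun i => a *: u i + v i) => //.
rewrite /canon_le scaler_sumr -big_split; apply: eq_bigr => i _.
by rewrite linearP.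
Qed.
Lemma canon_le_act m n (s : 'S_n) x :
  range (@canon_le m n) x -> range (@canon_le m n) (act s x).
Proof.
move=> [u _ <-]; exists (fun i => act s (u i)) => //.
by rewrite /canon_le linear_sum; apply: eq_bigr => i _; rewrite symhom_act.
Qed.
Definition canon_image (m : nat) : subrep A :=
  @SubRep k A (fun n => range (@canon_le m n)) (@canon_le0 m) (@canon_leP m)
    (@canon_le_act m).

(* The canonical map Sym(V) -> A is surjective. *)
Definition generates : Prop := forall n (a : A n), exists m, canon_image m n a.

Definition growth_exponents (R : realType) (l : nat -> nat) : set R :=
  [set r | exists c : R, forall m, (1 <= m)%N -> (l m)%:R <= c * m%:R `^ r].

(* d = dim(A; V) *)
Definition has_dim (R : realType) (d : \bar R) : Prop :=
  exists l : nat -> nat,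
    (forall m, has_length (canon_image m) (l m)) /\
    match d with
    | r%:E => @growth_exponents R l r /\ (forall r', @growth_exponents R l r' -> r <= r')
    | +oo%E => @growth_exponents R l = set0
    | -oo%E => False
    end.
End Growth.

(* GKdim(A) = d: A is finitely generated, and dim(A; V) = d for every finite
   length subobject V generating A. *)
Definition has_GKdim (R : realType) (A : tca) (d : \bar R) : Prop :=
  (exists (V : symrep k) (f : symhom V A), [/\ finite_length V, mono f & generates f]) /\
  forall (V : symrep k) (f : symhom V A),
    finite_length V -> mono f -> generates f -> has_dim f d.

End Day.

Section TensorAlgebra.
Context (k : fieldType) (W : lmodType k).

Definition update n (w : 'I_n -> W) (i : 'I_n) (x : W) : 'I_n -> W :=
  fun j => if j == i then x else w j.

Definition multilinear n (M : lmodType k) (b : ('I_n -> W) -> M) : Prop :=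
  forall w i, linear (fun x => b (update w i x)).

(* W^{(x) n} *)
Definition tensor n : lmodType k := presented (@multilinear n).
Definition tgen n (w : 'I_n -> W) : tensor n := gen (@multilinear n) w.

Lemma tgenL n : multilinear (@tgen n).
Proof.
move=> w i a x y; apply: presP => M b Pb; rewrite (pval_linear Pb) !pval_gen //.
exact: Pb.
Qed.

Lemma tensor_ext n (M : lmodType k) (f h : tensor n -> M) : linear f -> linear h ->
  (forall w, f (tgen w) = h (tgen w)) -> forall u, f u = h u.
Proof.
move=> Lf Lh fh u; rewrite -(mklinE Lf) -(mklinE Lh).
by apply: pres_ext => w; rewrite !mklinE; exact: fh.
Qed.

Definition tperm_fun n (s : 'S_n) (w : 'I_n -> W) : 'I_n -> W := fun x => w (s^-1%g x).

Lemma tperm_update n (s : 'S_n) w i x :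
  tperm_fun s (update w i x) = update (tperm_fun s w) (s i) x.
Proof.
by apply: funext => j; rewrite /tperm_fun /update -(inj_eq (@perm_inj _ s)) permKV.
Qed.

Lemma tact_multilinear n (s : 'S_n) : multilinear (fun w => tgen (tperm_fun s w)).
Proof. by move=> w i a x y; rewrite !tperm_update tgenL. Qed.
Definition tact n (s : 'S_n) : {linear tensor n -> tensor n} :=
  plift (@tact_multilinear n s).
Lemma tactE n (s : 'S_n) w : tact s (tgen w) = tgen (tperm_fun s w).
Proof. exact: plift_gen. Qed.

Lemma tact1 n x : tact (1 : 'S_n)%g x = x.
Proof.
move: x; apply: tensor_ext => [a x y|a x y|w]; rewrite ?linearP // tactE.
by congr tgen; apply: funext => i; rewrite /tperm_fun invg1 perm1.
Qed.
Lemma tactM n (s t : 'S_n) x : tact (t * s)%g x = tact s (tact t x).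
Proof.
move: x; apply: tensor_ext => [a x y|a x y|w]; rewrite ?linearP // !tactE.
by congr tgen; apply: funext => i; rewrite /tperm_fun invMg permM.
Qed.
Definition tensor_rep : symrep k := SymRep tact1 tactM.

Definition conc i j n (E : (i + j = n)%N) (w : 'I_i -> W) (w' : 'I_j -> W) : 'I_n -> W :=
  fun x => match locate E x with inl y => w y | inr z => w' z end.

Lemma conc_place i j n (E : (i + j = n)%N) w w' s :
  conc E w w' (place E s) = match s with inl y => w y | inr z => w' z end.
Proof. by rewrite /conc placeK. Qed.

Lemma eq_conc i j n (E : (i + j = n)%N) (w w' : 'I_n -> W) :
  (forall s, w (place E s) = w' (place E s)) -> w = w'.
Proof. by move=> H; apply: funext => x; rewrite -(locateK E x). Qed.

Lemma concL i j n (E : (i + j = n)%N) w w' a x :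
  conc E (update w a x) w' = update (conc E w w') (place E (inl a)) x.
Proof.
apply: (eq_conc (E := E)) => s.
by rewrite /update conc_place (can_eq (placeK E)); case: s => z //; rewrite conc_place.
Qed.
Lemma concR i j n (E : (i + j = n)%N) w w' a x :
  conc E w (update w' a x) = update (conc E w w') (place E (inr a)) x.
Proof.
apply: (eq_conc (E := E)) => s.
by rewrite /update conc_place (can_eq (placeK E)); case: s => z //; rewrite conc_place.
Qed.

Section TensorMul.
Context (i j n : nat) (E : (i + j = n)%N).
Lemma tmul_multilinear2 w : multilinear (fun w' : 'I_j -> W => tgen (conc E w w')).
Proof. by move=> w' a c x y; rewrite !concR tgenL. Qed.
Lemma tmul_multilinear (u : tensor j) :
  multilinear (fun w : 'I_i -> W => plift (tmul_multilinear2 w) u).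
Proof.
move=> w a c x y; move: u; apply: tensor_ext => [c' u v||w'].
- by rewrite linearP.
- by apply: lin_comb => c' u v; rewrite linearP.
- by rewrite ![plift _ _]plift_gen !concL tgenL.
Qed.
(* (w_1 ... w_i, w'_1 ... w'_j) |-> w_1 ... w_i w'_1 ... w'_j *)
Definition tmul (t : tensor i) (u : tensor j) : tensor n := plift (tmul_multilinear u) t.
Lemma tmulE w w' : tmul (tgen w) (tgen w') = tgen (conc E w w').
Proof. by rewrite /tmul [LHS]plift_gen [LHS]plift_gen. Qed.
Lemma tmulL u : linear (tmul^~ u).
Proof. by move=> a x y; rewrite /tmul linearP. Qed.
Lemma tmulR t : linear (tmul t).
Proof.
move=> a x y; move: t; apply: tensor_ext => [c u v||w].
- by rewrite tmulL.
- by apply: lin_comb => c u v; rewrite tmulL.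
- by rewrite /tmul ![plift _ (tgen w)]plift_gen linearP.
Qed.
End TensorMul.

Lemma tmul_ext i j n (E : (i + j = n)%N) (M : lmodType k) (f h : tensor i -> tensor j -> M) :
  (forall u, linear (f^~ u)) -> (forall u, linear (h^~ u)) ->
  (forall t, linear (f t)) -> (forall t, linear (h t)) ->
  (forall w w', f (tgen w) (tgen w') = h (tgen w) (tgen w')) -> forall t u, f t u = h t u.
Proof.
move=> fL hL fR hR fh t u; move: t; apply: tensor_ext => // w.
by move: u; apply: tensor_ext.
Qed.

Lemma tmul_block i j n (E : (i + j = n)%N) (s : 'S_i) (s' : 'S_j) t u :
  tact (block E s s') (tmul E t u) = tmul E (tact s t) (tact s' u).
Proof.
move: t; apply: tensor_ext => [a x y|a x y|w]; first by rewrite tmulL linearP.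
  by rewrite linearP tmulL.
move: u; apply: tensor_ext => [a x y|a x y|w']; first by rewrite tmulR linearP.
  by rewrite linearP tmulR.
rewrite !tactE !tmulE tactE; congr tgen; apply: funext => z.
rewrite -(permKV (block E s s') z) /tperm_fun permK.
rewrite -(locateK E ((block E s s')^-1%g z)) conc_place blockE conc_place.
by case: (locate _ _) => y; rewrite permK.
Qed.

Lemma tmul_shuffle i j n (E : (i + j = n)%N) (E' : (j + i = n)%N) t u :
  tact (shuffle E E') (tmul E' u t) = tmul E t u.
Proof.
move: t; apply: tensor_ext => [a x y|a x y|w]; first by rewrite tmulR linearP.
  by rewrite tmulL.
move: u; apply: tensor_ext => [a x y|a x y|w']; first by rewrite tmulL linearP.
  by rewrite tmulR.
rewrite !tmulE tactE; congr tgen; apply: funext => z.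
rewrite -(permKV (shuffle E E') z) /tperm_fun permK.
rewrite -(locateK E' ((shuffle E E')^-1%g z)) conc_place shuffleE conc_place.
by case: (locate _ _).
Qed.

Lemma tmul_assoc p q l i j n (Ei : (p + q = i)%N) (E : (i + l = n)%N)
  (Ej : (q + l = j)%N) (E' : (p + j = n)%N) t u v :
  tmul E (tmul Ei t u) v = tmul E' t (tmul Ej u v).
Proof.
move: t; apply: tensor_ext => [a x y|a x y|w]; rewrite ?tmulL //.
move: u; apply: tensor_ext => [a x y|a x y|w']; rewrite ?tmulL ?tmulR ?tmulL ?tmulR //.
move: v; apply: tensor_ext => [a x y|a x y|w'']; rewrite ?tmulR ?tmulR //.
rewrite !tmulE; congr tgen; apply: (eq_conc (E := E)) => -[y|z].
  rewrite -(locateK Ei y) conc_place conc_place.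
  case: (locate Ei y) => x; first by rewrite (placeA1 Ei E E') conc_place.
  by rewrite (placeA2 Ei E Ej E') !conc_place.
by rewrite conc_place (placeA3 Ei E Ej E') !conc_place.
Qed.

Definition tensor_mul_gen n (w : day_gen tensor_rep tensor_rep n) : tensor_rep n :=
  let: DayGen i j E g x y := w in tact g (tmul E x y).
Lemma tensor_mul_bal n : balanced (@tensor_mul_gen n).
Proof.
split=> [i j E g y a x x'|i j E g x a y y'|i j E g s t x y]; rewrite /tensor_mul_gen.
- by rewrite tmulL linearP.
- by rewrite tmulR linearP.
- by rewrite tactM tmul_block.
Qed.
Definition tensor_mul_fun n : {linear day tensor_rep tensor_rep n -> tensor_rep n} :=
  day_lift (@tensor_mul_bal n).
Lemma tensor_mul_funE n i j (E : (i + j = n)%N) g (x : tensor_rep i) (y : tensor_rep j) :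
  tensor_mul_fun n (pt E g x y) = tact g (tmul E x y).
Proof. exact: day_liftE. Qed.
Lemma tensor_mul_act n (s : 'S_n) u :
  tensor_mul_fun n (act s u) = act s (tensor_mul_fun n u).
Proof.
move: u; apply: day_ext => [a x y|a x y|i j E g x y]; rewrite ?linearP //.
by rewrite act_pt !tensor_mul_funE tactM.
Qed.
Definition tensor_mul : symhom (day tensor_rep tensor_rep) tensor_rep :=
  SymHom tensor_mul_act.
Lemma tensor_mulE n i j (E : (i + j = n)%N) g (x : tensor_rep i) (y : tensor_rep j) :
  tensor_mul n (pt E g x y) = tact g (tmul E x y).
Proof. exact: day_liftE. Qed.

Definition tensor_unit_fun n : unit_mod k n -> tensor n :=
  if n is 0%N then fun c : k^o => c *: tgen (fun _ => 0) else fun _ => 0.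
Lemma tensor_unitL n : linear (@tensor_unit_fun n).
Proof.
case: n => [|n] a x y /=; first by rewrite scalerDl scalerA.
by rewrite scaler0 addr0.
Qed.
Lemma tensor_unit_act n (s : 'S_n) u :
  mklin (@tensor_unitL n) (act (s : 'S_n) (u : unit_rep k n)) =
  act (s : 'S_n) (mklin (@tensor_unitL n) u : tensor_rep n).
Proof.
rewrite !(mklinE (@tensor_unitL n)); case: n s u => [|n] s u /=; last by rewrite linear0.
by rewrite linearZ; congr (_ *: _); rewrite [RHS]tactE.
Qed.
Definition tensor_unit : symhom (unit_rep k) tensor_rep :=
  @SymHom k (unit_rep k) tensor_rep (fun n => mklin (@tensor_unitL n)) tensor_unit_act.

Lemma tensor_algA : eqhom (comphom tensor_mul (dayhom tensor_mul (idhom tensor_rep)))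
    (comphom tensor_mul (comphom (dayhom (idhom tensor_rep) tensor_mul)
      (assoc tensor_rep tensor_rep tensor_rep))).
Proof.
move=> n; apply: day_ext => [a x y|a x y|i l E g u z]; rewrite ?linearP //.
move: u; apply: day_ext => [a x y|a x y|p q Ei h x y].
- by rewrite ptL linearP.
- by rewrite ptL linearP.
rewrite -[LHS]/(tensor_mul n (dayhom tensor_mul (idhom tensor_rep) n _)).
rewrite -[RHS]/(tensor_mul n (dayhom (idhom tensor_rep) tensor_mul n
  (assoc tensor_rep tensor_rep tensor_rep n _))).
rewrite assocE !dayhomE !tensor_mulE tactM tact1; congr (tact g _).
rewrite -(tmul_assoc Ei E) tmul_block /=; congr (tmul E _ _).
by rewrite tact1.
Qed.

Lemma tensor_alg1 :
  eqhom (comphom tensor_mul (dayhom tensor_unit (idhom tensor_rep))) (lunit tensor_rep).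
Proof.
move=> n; apply: day_ext => [a x y|a x y|i l E g c x]; rewrite ?linearP //.
rewrite -[LHS]/(tensor_mul n (dayhom tensor_unit (idhom tensor_rep) n _)).
rewrite -[RHS]/(lunit_fun tensor_rep n _).
rewrite dayhomE tensor_mulE [RHS]day_liftE (mklinE (@tensor_unitL i)) /=.
case: i E c => [|i] E c /=; last by rewrite -(mklinE (tmulL E x)) linear0 linear0.
case: n / E g => g.
rewrite -(mklinE (tmulL _ x)) linearZ (mklinE (tmulL _ x)) linearZ; congr (_ *: tact g _).
move: x; apply: tensor_ext => [a x y|a x y|w]; rewrite ?tmulR //.
rewrite tmulE; congr tgen; apply: (eq_conc (E := erefl (0 + l)%N)) => -[[]//|z].
by rewrite conc_place /=; congr w; apply: val_inj.
Qed.

Lemma tensor_algC :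
  eqhom (comphom tensor_mul (braid tensor_rep tensor_rep)) tensor_mul.
Proof.
move=> n; apply: day_ext => [a x y|a x y|i j E g x y]; rewrite ?linearP //.
rewrite -[LHS]/(tensor_mul n (braid tensor_rep tensor_rep n _)).
by rewrite braidE !tensor_mulE tactM tmul_shuffle.
Qed.

Definition tensor_algebra : tca k := Tca tensor_algA tensor_alg1 tensor_algC.
End TensorAlgebra.

(* Main.v *)
(* Let M be the S_j-module W^{(x)j} = k[words of length j in n letters].  The
   endomorphisms of M have a basis xi_a indexed by the n x n matrices a over the
   naturals with sum j.  On the space M^+ of highest weight vectors, every xi_a
   is a combination of those xi_b with b lower triangular (Gaussian elimination),
   and every nonzero submodule of M maps nontrivially to M^+.

   Upper bound: Hom(M^+, U) grows strictly with the submodule U, so the length of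
   M is at most the number of lower triangular b.  Summed over j <= D this is at
   most (D + 1)^N, with N = n(n+1)/2.

   Lower bound: for U'/U simple, Hom(U'/U, M) is spanned by xi_b's with b lower
   triangular of prescribed column sums, so it has dimension at most
   (j + 1)^C(n,2).  As End(M) is filtered by such spaces, the number of all
   matrices a is at most length(M) (j + 1)^C(n,2); summed over j <= m the left
   side has order m^(n^2), and n^2 - C(n,2) = N.

   If V generates T(W), then V_1 = W, so the image of Sym^{<= m}(V) contains all
   degrees up to m, and it lies in degrees at most dm if V lives in degrees <= d. *)
Require Import Defs.
From mathcomp Require Import all_boot all_order all_fingroup all_algebra.
From mathcomp Require Import reals ereal.
From mathcomp Require Import boolp classical_sets exp zify.

Set Implicit Arguments.
Unset Strict Implicit.
Unset Printing Implicit Defensive.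

Import Order.TTheory GRing.Theory Num.Theory.
Local Open Scope ring_scope.

(* Both names are shadowed by the imports. *)
Local Notation act := Defs.act.
Local Notation canon := Defs.canon.

(** * Equivariant endomorphisms *)

(** A subspace inside [P] of maximal dimension is all of [P], since a missing vector could be
    adjoined. This gives a dimension to submodules described by propositions. *)
Lemma vspace_of_pred (k : fieldType) (vT : vectType k) (P : vT -> Prop) :
  P 0 -> (forall a x y, P x -> P y -> P (a *: x + y)) ->
  exists U : {vspace vT}, forall x, x \in U <-> P x.
Proof.
move=> P0 PD.
pose inP (U : {vspace vT}) := forall x, x \in U -> P x.
pose d m := `[< exists U, inP U /\ \dim U = m >].
have ex : exists m, d m.
  exists 0%N; apply/asboolP; exists 0%VS; split; last exact: dimv0.
  by move=> x; rewrite memv0 => /eqP ->.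
have ub m : d m -> (m <= \dim {:vT})%N.
  by move=> /asboolP [U [_ <-]]; apply: dimvS; apply: subvf.
case: (ex_maxnP ex ub) => m /asboolP [U [UP dU]] max.
exists U => x; split; first exact: UP.
move=> Px; apply: contrapT => /negP xU.
have : d (\dim (<[x]> + U)%VS).
  apply/asboolP; exists (<[x]> + U)%VS; split=> // y /memv_addP [_ /vlineP [a ->] [z zU ->]].
  by apply: PD => //; apply: UP.
move=> /max; rewrite -dU leqNgt => /negP; apply.
rewrite ltn_neqAle dimvS ?addvSr // andbT.
apply: contra xU => /eqP E.
have /eqP -> : U == (<[x]> + U)%VS by rewrite eqEdim addvSr E leqnn.
by apply: subvP (memv_line x); apply: addvSl.
Qed.

Section Maschke.
Context (k : fieldType) (gT : finGroupType) (M : vectType k) (rho : gT -> 'End(M)).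
Hypothesis rho1 : rho 1%g = \1%VF.
Hypothesis rhoM : forall s t, rho (t * s)%g = (rho s \o rho t)%VF.
Hypothesis card_neq0 : #|gT|%:R != 0 :> k.

Definition equivariant (A : 'End(M)) : Prop := forall g, (rho g \o A = A \o rho g)%VF.

(** The Reynolds operator, which projects onto the equivariant endomorphisms. *)
Definition average (A : 'End(M)) : 'End(M) :=
  (#|gT|%:R)^-1 *: \sum_(g : gT) (rho g^-1%g \o A \o rho g)%VF.

Lemma rhoKV g : (rho g^-1%g \o rho g = \1)%VF.
Proof. by rewrite -rhoM mulgV rho1. Qed.

Lemma equivariantE A : equivariant A -> forall g x, rho g (A x) = A (rho g x).
Proof. by move=> eA g x; rewrite -!comp_lfunE eA. Qed.

Lemma equivariant_comp A B : equivariant A -> equivariant B -> equivariant (A \o B)%VF.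
Proof. by move=> eA eB g; rewrite comp_lfunA eA -comp_lfunA eB comp_lfunA. Qed.

Lemma equivariant1 : equivariant \1%VF.
Proof. by move=> g; rewrite comp_lfun1l comp_lfun1r. Qed.

Lemma equivariantP a A B : equivariant A -> equivariant B -> equivariant (a *: A + B).
Proof.
by move=> eA eB g; rewrite comp_lfunDr comp_lfunDl -comp_lfunZr -comp_lfunZl eA eB.
Qed.

Lemma equivariantB A B : equivariant A -> equivariant B -> equivariant (A - B).
Proof. by move=> eA eB; rewrite addrC -scaleN1r; apply: equivariantP. Qed.

Lemma averageE A x : average A x = (#|gT|%:R)^-1 *: \sum_(g : gT) rho g^-1%g (A (rho g x)).
Proof.
by rewrite scale_lfunE sum_lfunE; congr (_ *: _); apply: eq_bigr => g _; rewrite !comp_lfunE.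
Qed.

Lemma average_equivariant A : equivariant (average A).
Proof.
move=> h; apply/lfunP => x; rewrite !comp_lfunE !averageE linearZ linear_sum; congr (_ *: _).
rewrite (reindex_inj (mulgI h)); apply: eq_bigr => g _ /=.
by rewrite -comp_lfunE -rhoM invMg mulgKV rhoM comp_lfunE.
Qed.

Lemma average_comp A B C : equivariant B -> equivariant C ->
  (B \o average A \o C)%VF = average (B \o A \o C)%VF.
Proof.
move=> eB eC; apply/lfunP => x; rewrite !comp_lfunE !averageE linearZ linear_sum; congr (_ *: _).
by apply: eq_bigr => g _ /=; rewrite -(equivariantE eB) !comp_lfunE (equivariantE eC).
Qed.

Lemma average_const (A : 'End(M)) x y : (forall g, rho g^-1%g (A (rho g x)) = y) -> average A x = y.
Proof.
move=> Ay; rewrite averageE (eq_bigr (fun=> y)) => [|g _]; last exact: Ay.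
by rewrite sumr_const -scaler_nat scalerA mulVf ?scale1r.
Qed.

Lemma average_id A : equivariant A -> average A = A.
Proof.
move=> eA; apply/lfunP => x; apply: average_const => g.
by rewrite -(equivariantE eA) -comp_lfunE rhoKV lfunE.
Qed.

(** The commutant is von Neumann regular: [r^-1] is a generalized inverse of [r], and averaging
    commutes with composition by [r] on both sides. *)
Lemma equivariant_inverse r : equivariant r ->
  exists2 s, equivariant s & (r \o s \o r = r)%VF.
Proof.
move=> er; exists (average (r^-1)%VF); first exact: average_equivariant.
by rewrite average_comp // inv_lfun_def average_id.
Qed.

Definition stable (U : {vspace M}) : Prop := forall g x, x \in U -> rho g x \in U.

(** Maschke: the average of a linear projection onto [U] still maps into [U] and fixes it. *)
Lemma equivariant_proj U : stable U ->
  exists2 p, equivariant p & (forall x, p x \in U) /\ (forall x, x \in U -> p x = x).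
Proof.
move=> sU; exists (average (projv U)); first exact: average_equivariant.
split=> x.
  by rewrite averageE memvZ // memv_suml // => g _; rewrite sU ?memv_proj.
move=> xU; apply: average_const => g.
by rewrite projv_id ?sU // -comp_lfunE rhoKV lfunE.
Qed.

(* An equivariant idempotent onto a complement of U in U'. *)
Lemma equivariant_quot U U' : stable U -> stable U' -> (U <= U')%VS ->
  exists q, [/\ equivariant q, forall x, q x \in U', forall x, x \in U' -> x - q x \in U,
    forall x, x \in U -> q x = 0 & forall x, q (q x) = q x].
Proof.
move=> sU sU' UU'.
have [p ep [pU pK]] := equivariant_proj sU.
have [p' ep' [pU' pK']] := equivariant_proj sU'.
have in' x : p x \in U' by apply: subvP (pU x).
(* [p'] projects onto [U']; then [1 - p] kills [U] and stays inside [U'], because [p] has its values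
   in [U]. *)
exists ((\1 - p) \o p')%VF.
have E x : ((\1 - p) \o p')%VF x = p' x - p (p' x).
  by rewrite comp_lfunE add_lfunE opp_lfunE lfunE.
split=> [|x|x xU|x xU|x]; rewrite ?E.
- by apply: equivariant_comp => //; apply: equivariantB => //; apply: equivariant1.
- by rewrite memvB.
- by rewrite pK' // opprB addrC subrK.
- by rewrite pK' ?(subvP UU') // pK // subrr.
- by rewrite pK' ?memvB // linearB /= (pK (p (p' x))) ?pU // subrr subr0.
Qed.
End Maschke.

(** * Highest weight vectors in words *)

Section Words.
Context (k : fieldType) (n j : nat).

Definition word := {ffun 'I_j -> 'I_n}.
(** The coordinates of a tensor: [x w] is the coefficient of the word [w]. *)
Definition wordfun := {ffun word -> k^o}.
Implicit Types (w v u : word) (x : wordfun) (s t : 'S_j).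

Definition wact s w : word := [ffun i => w (s i)].
Lemma wactM s t w : wact (s * t)%g w = wact s (wact t w).
Proof. by apply/ffunP => i; rewrite !ffunE permM. Qed.
Lemma wact1 w : wact 1%g w = w.
Proof. by apply/ffunP => i; rewrite !ffunE perm1. Qed.
Lemma wactK s : cancel (wact s) (wact s^-1%g).
Proof. by move=> w; rewrite -wactM mulVg wact1. Qed.
Lemma wact_inj s : injective (wact s).
Proof. exact: can_inj (wactK s). Qed.

Definition perm_fun s x : wordfun := [ffun w => x (wact s w)].
Lemma perm_fun_linear s : linear (perm_fun s).
Proof. by move=> a x y; apply/ffunP => w; rewrite !ffunE. Qed.
Definition rho s : 'End(wordfun) := linfun (mklin (@perm_fun_linear s)).
Lemma rhoE s x w : rho s x w = x (wact s w).
Proof. by rewrite lfunE /= mklinE ffunE. Qed.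
Lemma rho1 : rho 1%g = \1%VF.
Proof. by apply/lfunP => x; apply/ffunP => w; rewrite rhoE wact1 lfunE. Qed.
Lemma rhoM s t : rho (t * s)%g = (rho s \o rho t)%VF.
Proof. by apply/lfunP => x; apply/ffunP => w; rewrite comp_lfunE !rhoE wactM. Qed.

Definition kernel_fun (K : word -> word -> k) x : wordfun := [ffun w => \sum_v K w v * x v].
Lemma kernel_fun_linear K : linear (kernel_fun K).
Proof.
move=> a x y; apply/ffunP => w; rewrite !ffunE scaler_sumr -big_split.
by apply: eq_bigr => v _; rewrite !ffunE mulrDr /= scalerAr.
Qed.
Definition kernel_op K : 'End(wordfun) := linfun (mklin (@kernel_fun_linear K)).
Lemma kernel_opE K x w : kernel_op K x w = \sum_v K w v * x v.
Proof. by rewrite lfunE /= mklinE ffunE. Qed.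

Definition delta v : wordfun := [ffun w => (w == v)%:R].
Lemma kernel_op_delta K v w : kernel_op K (delta v) w = K w v.
Proof.
rewrite kernel_opE (bigD1 v) //= ffunE eqxx mulr1 big1 ?addr0 // => u /negPf uv.
by rewrite ffunE uv mulr0.
Qed.
Lemma wordfun_sum x : x = \sum_v x v *: delta v.
Proof.
apply/ffunP => w; rewrite sum_ffunE (bigD1 w) //= !ffunE eqxx.
rewrite big1 ?addr0 => [|u /negPf uw]; first by rewrite /GRing.scale /= mulr1.
by rewrite !ffunE eq_sym uw scaler0.
Qed.
Lemma end_kernel (A : 'End(wordfun)) : A = kernel_op (fun w v => A (delta v) w).
Proof.
apply/lfunP => x; apply/ffunP => w; rewrite kernel_opE {1}(wordfun_sum x) linear_sum sum_ffunE.
by apply: eq_bigr => v _; rewrite linearZ ffunE; exact: mulrC.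
Qed.

Lemma rho_delta s v : rho s (delta (wact s v)) = delta v.
Proof. by apply/ffunP => w; rewrite rhoE !ffunE (inj_eq (@wact_inj s)). Qed.

Lemma kernel_op_equivariant K : (forall s w v, K (wact s w) (wact s v) = K w v) ->
  equivariant rho (kernel_op K).
Proof.
move=> KE s; apply/lfunP => x; apply/ffunP => w; rewrite !comp_lfunE rhoE !kernel_opE.
by rewrite (reindex_inj (@wact_inj s)); apply: eq_bigr => v _; rewrite KE rhoE.
Qed.

Lemma equivariant_kernel A : equivariant rho A ->
  forall s w v, A (delta (wact s v)) (wact s w) = A (delta v) w.
Proof.
by move=> eA s w v; rewrite -rhoE (equivariantE eA) rho_delta.
Qed.

Definition pairtype := {ffun 'I_n * 'I_n -> nat}.
Implicit Types (a b : pairtype) (p q l : 'I_n).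

(** A complete invariant of the orbit of [(w, v)] under simultaneous permutation of positions. *)
Definition pair_type w v : pairtype := [ffun c => #|[pred i | (w i, v i) == c]|].

Lemma pair_type_act s w v : pair_type (wact s w) (wact s v) = pair_type w v.
Proof.
apply/ffunP => c; rewrite !ffunE -!sum1_card [RHS](reindex_inj (@perm_inj _ s)).
by apply: eq_bigl => i; rewrite !inE !ffunE.
Qed.

Lemma pair_type_gt0 w v i : (0 < pair_type w v (w i, v i))%N.
Proof. by rewrite ffunE; apply/card_gt0P; exists i; rewrite inE. Qed.

Lemma pair_type_sum w v : (\sum_c pair_type w v c = j)%N.
Proof.
under eq_bigr do rewrite ffunE -sum1_card.
rewrite (exchange_big_dep xpredT) //= -[RHS]card_ord -sum1_card.
by apply: eq_bigr => i _; rewrite (big_pred1 (w i, v i)) // => c; rewrite inE eq_sym.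
Qed.

(** Two sequences of pairs with equal multiplicities are rearrangements of each other. *)
Lemma pair_type_orbit w v w' v' : pair_type w v = pair_type w' v' ->
  exists s, w' = wact s w /\ v' = wact s v.
Proof.
move=> E; pose tw w v := [tuple (w i, v i) | i < j].
have : perm_eq (tw w' v') (tw w v).
  have cnt (u u' : word) c : count_mem c (tw u u') = pair_type u u' c.
    rewrite count_map ffunE cardE /enum_mem size_filter -enumT /=.
    by apply: eq_count => i; rewrite /= inE.
  apply/allP => c _; apply/eqP; apply: etrans (cnt _ _ _) _; rewrite -E.
  exact: esym (cnt _ _ _).
case/tuple_permP => s Es; exists s.
have P i : (w' i, v' i) = (w (s i), v (s i)).
  have /(congr1 (fun r => tnth r i)) : tw w' v' = [tuple tnth (tw w v) (s i) | i < j].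
    exact: val_inj.
  by rewrite !tnth_mktuple.
by split; apply/ffunP => i; rewrite ffunE; case: (P i).
Qed.

Lemma pair_type_exists a : (\sum_c a c = j)%N -> exists w v, pair_type w v = a.
Proof.
move=> aj; pose r := flatten [seq nseq (a c) c | c <- enum {: 'I_n * 'I_n}].
have sr : size r == j.
  rewrite size_flatten /shape -map_comp sumnE big_map big_enum /= -[X in _ == X]aj.
  by apply/eqP; apply: eq_bigr => c _; rewrite /= size_nseq.
pose t := Tuple sr.
exists [ffun i => (tnth t i).1], [ffun i => (tnth t i).2]; apply/ffunP => c.
have -> : a c = count_mem c r.
  rewrite count_flatten -map_comp sumnE big_map big_enum /= (bigD1 c) //= count_nseq /= eqxx mul1n.
  by rewrite big1 ?addn0 // => d /negPf dc; rewrite count_nseq /= dc.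
rewrite ffunE cardE /enum_mem size_filter -enumT -[r]/(tval t) -[tval t]map_tnth_enum count_map.
by apply: eq_count => i; rewrite /= inE !ffunE -surjective_pairing.
Qed.

(** The weight of the word for the diagonal torus of GL_n. *)
Definition content w : {ffun 'I_n -> nat} := [ffun q => #|[pred i | w i == q]|].

Lemma pair_type_column w v q : (\sum_l pair_type w v (l, q) = content v q)%N.
Proof.
rewrite ffunE -sum1_card (eq_bigr (fun l => \sum_(i | (w i == l) && (v i == q)) 1%N)) => [|l _].
  rewrite (exchange_big_dep (fun i => v i == q)) /= => [|l i _ /andP [] //].
  by apply: eq_bigr => i vi; rewrite (big_pred1 (w i)) // => l; rewrite vi andbT eq_sym.
by rewrite ffunE -sum1_card; apply: eq_bigl => i; rewrite inE xpair_eqE.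
Qed.

Lemma content_act s w : content (wact s w) = content w.
Proof.
apply/ffunP => q; rewrite !ffunE -!sum1_card [RHS](reindex_inj (@perm_inj _ s)).
by apply: eq_bigl => i; rewrite !inE ffunE.
Qed.

Definition upd w i q : word := [ffun i' => if i' == i then q else w i'].

Lemma upd_upd w i q p : upd (upd w i q) i p = upd w i p.
Proof. by apply/ffunP => i'; rewrite !ffunE; case: eqP. Qed.
Lemma upd_id w i : upd w i (w i) = w.
Proof. by apply/ffunP => i'; rewrite !ffunE; case: eqP => [->|]. Qed.
Lemma upd_act s w i q : upd (wact s w) i q = wact s (upd w (s i) q).
Proof. by apply/ffunP => i'; rewrite !ffunE (inj_eq perm_inj). Qed.

(* The action of the elementary matrix E_pq of gl_n on the words. *)
Definition raise p q : 'End(wordfun) :=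
  kernel_op (fun w v => \sum_(i | w i == p) (v == upd w i q)%:R).

Lemma raiseE p q x w : raise p q x w = \sum_(i | w i == p) x (upd w i q).
Proof.
rewrite kernel_opE; under eq_bigr do rewrite mulr_suml.
rewrite exchange_big /=; apply: eq_bigr => i _.
by rewrite (bigD1 (upd w i q)) //= eqxx mul1r big1 ?addr0 // => v /negPf ->; rewrite mul0r.
Qed.

Lemma raise_equivariant p q : equivariant rho (raise p q).
Proof.
apply: kernel_op_equivariant => s w v; rewrite [RHS](reindex_inj (@perm_inj _ s)).
by apply: eq_big => i; rewrite !ffunE // => _; rewrite upd_act (inj_eq (@wact_inj s)).
Qed.

Definition content_proj (mu : {ffun 'I_n -> nat}) : 'End(wordfun) :=
  kernel_op (fun w v => ((v == w) && (content w == mu))%:R).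

Lemma content_projE mu x w : content_proj mu x w = if content w == mu then x w else 0.
Proof.
rewrite kernel_opE (bigD1 w) //= eqxx big1 ?addr0 => [|v /negPf ->]; last by rewrite mul0r.
by case: eqP; rewrite ?mul1r ?mul0r.
Qed.

Lemma content_proj_equivariant mu : equivariant rho (content_proj mu).
Proof.
by apply: kernel_op_equivariant => s w v; rewrite (inj_eq (@wact_inj s)) content_act.
Qed.

Definition highest x : Prop := forall p q, (p < q)%N -> raise p q x = 0.
Definition has_content mu x : Prop := forall w, content w != mu -> x w = 0.

(** The sum of the letters thus depends on the content only; it is the quantity minimized in
    [highest_exists]. *)
Lemma weight_sum w : (\sum_(p < n) p * content w p = \sum_i w i)%N.
Proof.
rewrite (eq_bigr (fun p : 'I_n => \sum_(i | w i == p) (w i : nat))%N) => [|p _].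
  rewrite (exchange_big_dep xpredT) //=; apply: eq_bigr => i _.
  by rewrite (big_pred1 (w i)) // => p; rewrite eq_sym.
rewrite ffunE (eq_bigr (fun=> p : nat)) => [|i /eqP -> //].
by rewrite sum_nat_const mulnC.
Qed.

(* Choose r so that a word with minimal sum of letters occurs in the image of r A:
   the raising operators lower that sum, and hence vanish on the image. *)
Lemma highest_exists A : equivariant rho A -> A != 0 ->
  exists r mu, [/\ equivariant rho r, (r \o A)%VF != 0,
    forall x, highest ((r \o A)%VF x) & forall x, has_content mu ((r \o A)%VF x)].
Proof.
move=> eA A0.
pose d m := `[< exists r x w, [/\ equivariant rho r, r (A x) w != 0 & (\sum_i w i = m)%N] >].
have ex : exists m, d m.
  have [v Av] : exists v, A (delta v) != 0.
    apply: contrapT => H; move/eqP: A0; apply; apply/lfunP => x.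
    rewrite (wordfun_sum x) !linear_sum; apply: eq_bigr => v _; rewrite !linearZ /=.
    by rewrite lfunE /=; congr (_ *: _); apply: contrapT => /eqP Av; apply: H; exists v.
  have [w Aw] : exists w, A (delta v) w != 0.
    apply: contrapT => H; move/eqP: Av; apply; apply/ffunP => w; rewrite [RHS]ffunE.
    by apply: contrapT => /eqP Aw; apply: H; exists w.
  exists (\sum_i w i)%N; apply/asboolP; exists \1%VF, (delta v), w; split=> //.
    exact: equivariant1.
  by rewrite lfunE.
case: (ex_minnP ex) => m /asboolP [r [x [w [er rw wm]]]] min.
have le_m r' x' w' : equivariant rho r' -> (\sum_i w' i < m)%N -> r' (A x') w' = 0.
  move=> er' lt; apply: contrapT => /eqP rw'.
  have /min : d (\sum_i w' i)%N by apply/asboolP; exists r', x', w'.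
  by rewrite leqNgt lt.
(* Projecting onto the weight of the minimal word [w] keeps the value at [w], so the composite
   remains nonzero. *)
exists (content_proj (content w) \o r)%VF, (content w).
have erp := content_proj_equivariant (content w).
split=> [||x' p q pq|x' u /negPf uw].
- exact: equivariant_comp.
- apply: contra rw => /eqP /lfunP /(_ x) /ffunP /(_ w).
  by rewrite !comp_lfunE content_projE eqxx lfunE /= ffunE => ->.
- apply/ffunP => u; rewrite !comp_lfunE [RHS]ffunE.
  have [lt|ge] := ltnP (\sum_i u i) m.
    have := le_m (raise p q \o (content_proj (content w) \o r))%VF x' u _ lt.
    rewrite !comp_lfunE; apply.
    exact: equivariant_comp (raise_equivariant p q) (equivariant_comp erp er).
  (* Changing a letter [p] of [u] into [q > p] brings the sum above [m], so the new word cannot have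
     the content of [w]. *)
  rewrite raiseE big1 // => i /eqP ui; rewrite content_projE.
  case: eqP => // /(congr1 (fun f : {ffun 'I_n -> nat} => \sum_(p < n) p * f p)%N).
  rewrite !weight_sum wm => E; move: ge; rewrite -E leqNgt => /negP [].
  rewrite (bigD1 i) //= [X in (_ < X)%N](bigD1 i) //= ffunE eqxx ui.
  rewrite [X in (_ < _ + X)%N](eq_bigr (fun i => u i : nat)) => [|i' /negPf i'i].
    by rewrite ltn_add2r.
  by rewrite ffunE i'i.
- by rewrite !comp_lfunE content_projE uw.
Qed.

End Words.

(** * The Schur algebra *)

Section Schur.
Context (k : fieldType) (n j : nat).
Local Notation word := (word n j).
Local Notation wordfun := (wordfun k n j).
Local Notation pairtype := (pairtype n).
Implicit Types (w v u : word) (x : wordfun) (s : 'S_j) (a : pairtype) (p q l : 'I_n).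

(* The basis of the Schur algebra End_{S_j} given by the orbits of S_j on pairs of words. *)
Definition xi a : 'End(wordfun) := kernel_op (fun w v => (pair_type w v == a)%:R).

Lemma xiE a x w : xi a x w = \sum_(v | pair_type w v == a) x v.
Proof.
rewrite kernel_opE [RHS]big_mkcond /=; apply: eq_bigr => v _.
by case: eqP; rewrite ?mul1r ?mul0r.
Qed.

Lemma xi_eq0 a : (\sum_c a c)%N != j -> xi a = 0.
Proof.
move=> aj; apply/lfunP => x; apply/ffunP => w; rewrite xiE lfunE /= ffunE big_pred0 // => v.
by apply: contraNF aj => /eqP <-; rewrite pair_type_sum.
Qed.

(** The effect on the pair type when a letter [p] of the second word, facing [l] in the first,
    becomes [q]. The predecessor is truncated, whence the positivity conditions on [a (l, p)]
    below. *)
Definition shift_pair p q l a : pairtype :=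
  [ffun c => if c == (l, p) then (a c).-1 else if c == (l, q) then (a c).+1 else a c].

Lemma shift_pairK p q l a : p != q -> (0 < a (l, p))%N ->
  shift_pair q p l (shift_pair p q l a) = a.
Proof.
move=> /negPf pq ap; apply/ffunP => c; rewrite !ffunE.
case: (eqVneq c (l, q)) => [->|]; first by rewrite xpair_eqE eqxx eq_sym pq.
by case: (eqVneq c (l, p)) => [->|] //; rewrite prednK.
Qed.

Lemma pair_type_upd p q w v i : v i = p -> p != q ->
  pair_type w (upd v i q) = shift_pair p q (w i) (pair_type w v).
Proof.
move=> vi /negPf pq; apply/ffunP => c.
have cnt (u : word) : pair_type w u c =
    (((w i, u i) == c) + \sum_(i' | i' != i) ((w i', u i') == c))%N.
  by rewrite ffunE -sum1_card big_mkcond (bigD1 i) //= inE; congr (_ + _)%N.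
rewrite [RHS]ffunE !cnt ffunE eqxx vi.
rewrite (eq_bigr (fun i' => ((w i', v i') == c) : nat)) => [|i' /negPf i'i]; last first.
  by rewrite ffunE i'i.
rewrite ![_ == c]eq_sym; case: (eqVneq c (w i, p)) => [->|_]; first by rewrite xpair_eqE eqxx pq.
by case: eqVneq.
Qed.

(** Multiplication of [xi a] by an elementary matrix in the Schur algebra, by double counting. A
    word [v] of type [a] against [w] and a position [i] with [v i = p] yield [u = upd v i q], of
    shifted type for [l = w i]; conversely [i] can be any of the [(a (l, q)).+1] positions where
    [(w, u)] carries [(l, q)]. *)
Lemma xi_raise a p q x : p != q ->
  xi a (raise k j p q x) =
  \sum_(l | (0 < a (l, p))%N) (a (l, q)).+1%:R *: xi (shift_pair p q l a) x.
Proof.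
move=> pq; apply/ffunP => w; rewrite xiE sum_ffunE.
transitivity (\sum_i \sum_(u : word | [&& u i == q, (0 < a (w i, p))%N &
    pair_type w u == shift_pair p q (w i) a]) x u).
  under eq_bigr do rewrite raiseE.
  rewrite (exchange_big_dep xpredT) //=; apply: eq_bigr => i _.
  rewrite [RHS](reindex_onto (fun v => upd v i q) (fun u => upd u i p)) /=; last first.
    by move=> u /and3P [/eqP uq _ _]; rewrite upd_upd -uq upd_id.
  apply: eq_bigl => v; rewrite upd_upd ffunE eqxx /=; apply/andP/andP => [[/eqP av /eqP vi]|].
    rewrite -av -vi pair_type_gt0 upd_id eqxx; split=> //=.
    by rewrite (pair_type_upd _ vi) // vi.
  case=> /and3P [_ a0 /eqP E] /eqP vi; have vip : v i = p by rewrite -vi ffunE eqxx.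
  rewrite vip eqxx; split=> //; apply/eqP.
  have := congr1 (shift_pair q p (w i)) E; rewrite (pair_type_upd _ vip) // !shift_pairK //.
  by rewrite -vip pair_type_gt0.
transitivity (\sum_(l | (0 < a (l, p))%N) \sum_(u : word | pair_type w u == shift_pair p q l a)
    \sum_(i | (w i, u i) == (l, q)) x u).
  rewrite (exchange_big_dep xpredT) //=.
  rewrite [RHS](exchange_big_dep xpredT) //=.
  apply: eq_bigr => u _; rewrite [RHS](exchange_big_dep (fun i => [&& u i == q, (0 < a (w i, p))%N &
    pair_type w u == shift_pair p q (w i) a])) /=; last first.
    by move=> l i /andP [al wu]; rewrite xpair_eqE => /andP [/eqP -> ->]; rewrite al.
  apply: eq_bigr => i /and3P [uq aw wu]; rewrite (big_pred1 (w i)) // => l.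
  rewrite xpair_eqE uq andbT [w i == l]eq_sym /=; case: (eqVneq l (w i)) => [->|].
    by rewrite aw wu.
  by rewrite andbF.
apply: eq_bigr => l al; rewrite ffunE xiE scaler_sumr; apply: eq_bigr => u /eqP E.
have -> : (a (l, q)).+1 = pair_type w u (l, q).
  by rewrite E ffunE eqxx xpair_eqE eqxx eq_sym (negPf pq).
by rewrite ffunE sumr_const scaler_nat.
Qed.

(** A matrix with sum [j] has entries at most [j], so the basis of the Schur algebra is indexed by a
    finite type. *)
Definition bounded_pair : finType := {ffun 'I_n * 'I_n -> 'I_j.+1}.
Definition nat_pair (b : bounded_pair) : pairtype := [ffun c => b c : nat].
Definition lower a : bool := [forall c : 'I_n * 'I_n, (c.1 < c.2)%N ==> (a c == 0)%N].
Definition total_pair (b : bounded_pair) : bool := (\sum_c b c == j)%N.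
Definition full_type : finType := {b : bounded_pair | total_pair b}.
Definition low_type : finType := {b : bounded_pair | total_pair b && lower (nat_pair b)}.

Lemma nat_pair_inj : injective nat_pair.
Proof.
move=> b b' /ffunP E; apply/ffunP => c; apply: val_inj.
by have := E c; rewrite !ffunE.
Qed.

Lemma nat_pairP a : (\sum_c a c = j)%N -> exists2 b, nat_pair b = a & total_pair b.
Proof.
move=> aj; have ba c : (a c < j.+1)%N by rewrite ltnS -aj (bigD1 c) //= leq_addr.
exists [ffun c => Ordinal (ba c)]; first by apply/ffunP => c; rewrite !ffunE.
by rewrite /total_pair -[X in _ == X]aj; apply/eqP/eq_bigr => c _; rewrite ffunE.
Qed.

Hypothesis char0 : [pchar k] =i pred0.

(** What elimination still has to clear in row [p]. *)
Let above a p := (\sum_(q : 'I_n | p < q) a (p, q))%N.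

(* Gaussian elimination: on highest weight vectors [xi_raise] has zero left hand
   side, which trades an entry above the diagonal for an entry on it. *)
Lemma xi_lower a : exists c : low_type -> k, forall x, highest x ->
  xi a x = \sum_b c b *: xi (nat_pair (val b)) x.
Proof.
pose good a := exists c : low_type -> k, forall x, highest x ->
  xi a x = \sum_b c b *: xi (nat_pair (val b)) x.
have sum_good (I : finType) (P : pred I) (d : I -> k) (f : I -> pairtype) a' :
    (forall i, P i -> good (f i)) ->
    (forall x, highest x -> xi a' x = \sum_(i | P i) d i *: xi (f i) x) -> good a'.
  move=> /= gf E.
  have /boolp.choice [c cE] : forall i, exists c : low_type -> k, P i -> forall x, highest x ->
      xi (f i) x = \sum_b c b *: xi (nat_pair (val b)) x.
    move=> i; case Pi: (P i); last by exists (fun=> 0).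
    by have [c cE] := gf i Pi; exists c.
  exists (fun b => \sum_(i | P i) d i * c i b) => x hx; rewrite E //.
  under [RHS]eq_bigr do rewrite scaler_suml.
  rewrite exchange_big /=; apply: eq_bigr => i Pi; rewrite cE // scaler_sumr.
  by apply: eq_bigr => b _; rewrite scalerA.
(* Rows are cleared from the top; only the last [m] rows may still have entries above the
   diagonal. *)
suff H m a' : (forall p, (p < n - m)%N -> above a' p = 0%N) -> good a'.
  by apply: (H n) => p; rewrite subnn.
elim: m a' => [|m IHm] a' low.
  have [aj|aj] := eqVneq (\sum_c a' c)%N j; last first.
    exists (fun=> 0) => x _; rewrite xi_eq0 // lfunE big1 // => b _; exact: scale0r.
  have [b ba tb] := nat_pairP aj.
  have lb : total_pair b && lower (nat_pair b).
    rewrite tb ba; apply/forallP => -[p q]; apply/implyP => /= pq; rewrite -leqn0.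
    by rewrite -(low p) ?subn0 // /above (bigD1 q) //= leq_addr.
  exists (fun b' => (b' == Sub b lb)%:R) => x _.
  rewrite (bigD1 (Sub b lb)) //= eqxx scale1r ba big1 ?addr0 // => b' /negPf ->.
  exact: scale0r.
have [mn|nm] := ltnP m n; last first.
  apply: IHm => p; rewrite (_ : n - m = 0)%N //; exact/eqP.
have pP : (n - m.+1 < n)%N by lia.
pose p := Ordinal pP.
(* Inner induction on the amount left above the diagonal in row [p]. *)
move: {2}(above a' p) (leqnn (above a' p)) => N.
elim: N a' low => [|N IHN] a' low aN.
  apply: IHm => p'; rewrite (_ : n - m = p.+1)%N; last by rewrite /p /=; lia.
  rewrite ltnS leq_eqVlt => /orP [/eqP/val_inj ->|/low //].
  by apply/eqP; rewrite -leqn0.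
have [a0|] := posnP (above a' p); first by apply: IHN => //; rewrite a0.
rewrite lt0n sum_nat_eq0 => /forall_inPn [q]; rewrite unfold_in => pq; rewrite -lt0n => apq.
have p_q : p != q by apply: contraTneq pq => ->; rewrite ltnn.
have q_p : q != p by rewrite eq_sym.
(* One unit of the entry [(p, q)] goes to the diagonal. Then [a'] is the term [l = p] of [xi_raise]
   for [a1], with coefficient [a' (p, q)], invertible in characteristic 0. *)
pose a1 := shift_pair q p p a'.
have a1p : (0 < a1 (p, p))%N.
  by rewrite ffunE !xpair_eqE !eqxx (negPf p_q).
have a1q : ((a1 (p, q)).+1 = a' (p, q))%N by rewrite ffunE eqxx prednK.
have a1K : shift_pair p q p a1 = a' by apply: shift_pairK.
apply: (sum_good 'I_n (fun l => (l != p) && (0 < a1 (l, p))%N)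
  (fun l => - (a' (p, q))%:R^-1 * (a1 (l, q)).+1%:R) (fun l => shift_pair p q l a1)).
  move=> l /andP [lp al]; apply: IHN.
    move=> p' p'p; have p'_p : p' != p.
      by apply: contraTneq p'p => ->; rewrite /p /= ltnn.
    (* Column [p] lies above the diagonal in a cleared row [p' < p], so its entry there is 0 and no
       term with [l = p'] occurs. *)
    have p'_l : p' != l.
      apply: contraTneq al => <-; rewrite ffunE !xpair_eqE (negPf p'_p) /= -leqNgt.
      rewrite -(low p') // /above (bigD1 p) //= ?leq_addr //.
    rewrite -[RHS](low p') //; apply: eq_bigr => q' _.
    by rewrite !ffunE !xpair_eqE (negPf p'_p) (negPf p'_l).
  (* For [l != p] row [p] is that of [a1], which has one unit less above the diagonal than [a']. *)
  rewrite -ltnS; apply: leq_trans aN.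
  rewrite /above (bigD1 q) //= [X in (_ < X)%N](bigD1 q) //= -a1q addSn ltnS.
  have p_l : (p == l) = false by rewrite eq_sym (negPf lp).
  rewrite leq_add //; first by rewrite ffunE !xpair_eqE p_l.
  apply: leq_sum => q' /andP [pq' /negPf q'q].
  have q'p : (q' == p) = false by apply: contraTF pq' => /eqP ->; rewrite ltnn.
  by rewrite !ffunE !xpair_eqE p_l q'q q'p /= andbF.
move=> x hx; have := xi_raise a1 x p_q.
rewrite hx // linear0 (bigD1 p) //= a1q a1K => E.
under eq_bigr => l _ do rewrite -scalerA.
rewrite -scaler_sumr; have nz : (a' (p, q))%:R != 0 :> k.
  by move/pcharf0P: char0 => ->; rewrite -lt0n.
apply: (scalerI nz); rewrite scalerA mulrN divff // scaleN1r.
apply/eqP; rewrite -addr_eq0; apply/eqP; rewrite [RHS]E; congr (_ + _).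
by apply: eq_bigl => l; rewrite andbC.
Qed.

End Schur.

(** * Chains of submodules in one degree *)

Lemma card_below n : #|[pred c : 'I_n * 'I_n | (c.2 < c.1)%N]| = 'C(n, 2).
Proof.
rewrite -sum1_card -(pair_big_dep xpredT (fun p q : 'I_n => q < p)%N (fun _ _ => 1%N)) /=.
rewrite -bin2_sum big_mkord; apply: eq_bigr => p _.
by rewrite -(big_ord_widen n (fun=> 1%N) (ltnW (ltn_ord p))) sum1_card card_ord.
Qed.

Section Chains.
Context (k : fieldType) (n j : nat).
Hypothesis char0 : [pchar k] =i pred0.
Local Notation word := (word n j).
Local Notation wordfun := (wordfun k n j).
Local Notation pairtype := (pairtype n).
Local Notation rho := (@rho k n j).
Local Notation full_type := (full_type n j).
Local Notation low_type := (low_type n j).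
Local Notation xi := (@xi k n j).
Implicit Types (w v u : word) (x : wordfun) (s : 'S_j) (a : pairtype) (U : {vspace wordfun}).

Let card_perm_neq0 : #|{perm 'I_j}|%:R != 0 :> k.
Proof. by move/pcharf0P: char0 => ->; rewrite -lt0n; apply/card_gt0P; exists 1%g. Qed.

Lemma xi_equivariant a : equivariant rho (xi a).
Proof. by apply: kernel_op_equivariant => s w v; rewrite pair_type_act. Qed.

Definition full_op (c : {ffun full_type -> k^o}) : 'End(wordfun) :=
  \sum_b c b *: xi (nat_pair (val b)).

Lemma full_op_linear : linear full_op.
Proof.
move=> a c d; rewrite /full_op scaler_sumr -big_split; apply: eq_bigr => b _.
by rewrite !ffunE scalerDl scalerA.
Qed.

(** Orbits are disjoint, so a coefficient is read off at any pair of words of its type; hence the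
    [xi] are independent. *)
Lemma full_op_delta c w v b : pair_type w v = nat_pair (val b) ->
  full_op c (delta k v) w = c b.
Proof.
move=> wv; rewrite sum_lfunE sum_ffunE (bigD1 b) //= scale_lfunE ffunE kernel_op_delta.
rewrite wv eqxx big1 => [|b' b'b]; first by rewrite addr0; exact: mulr1.
rewrite scale_lfunE ffunE kernel_op_delta wv (inj_eq (@nat_pair_inj _ _)) eq_sym.
by rewrite (inj_eq val_inj) (negPf b'b); exact: mulr0.
Qed.

Lemma full_type_word (b : full_type) : exists wv : word * word, pair_type wv.1 wv.2 = nat_pair (val b).
Proof.
have [|w [v E]] := @pair_type_exists n j (nat_pair (val b)).
  by under eq_bigr do rewrite ffunE; apply/eqP; exact: (valP b).
by exists (w, v).
Qed.

Lemma full_op_inj : injective full_op.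
Proof.
move=> c d E; apply/ffunP => b; have [[w v] /= wv] := full_type_word b.
by rewrite -(full_op_delta c wv) E (full_op_delta d wv).
Qed.

(** The matrix of an equivariant map is constant on orbits of pairs of words, and these are
    separated by [pair_type]. *)
Lemma equivariant_full A : equivariant rho A -> exists c, A = full_op c.
Proof.
move=> eA; have /boolp.choice [f fE] := full_type_word.
exists [ffun b => A (delta k (f b).2) (f b).1]; rewrite [LHS]end_kernel [RHS]end_kernel.
congr kernel_op; apply: funext => w; apply: funext => v.
have [b bE tb] := nat_pairP (pair_type_sum w v).
have := @full_op_delta [ffun b => A (delta k (f b).2) (f b).1] w v (Sub b tb).
rewrite SubK bE => -> //; rewrite ffunE.
have := fE (Sub b tb); rewrite SubK bE => E.
have [s [-> ->]] := pair_type_orbit E.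
by rewrite (equivariant_kernel eA).
Qed.

Lemma equivariant_lower A : equivariant rho A ->
  exists c : low_type -> k, forall x, highest x -> A x = \sum_b c b *: xi (nat_pair (val b)) x.
Proof.
move=> /equivariant_full [d ->].
have /boolp.choice [c cE] : forall b : full_type, exists c : low_type -> k, forall x, highest x ->
    xi (nat_pair (val b)) x = \sum_b c b *: xi (nat_pair (val b)) x.
  by move=> b; apply: xi_lower.
exists (fun b => \sum_b' d b' * c b' b) => x hx.
under [RHS]eq_bigr do rewrite scaler_suml.
rewrite exchange_big sum_lfunE; apply: eq_bigr => b _; rewrite scale_lfunE cE // scaler_sumr.
by apply: eq_bigr => b' _; rewrite scalerA.
Qed.

(* H is Hom(M^+, U) in the coordinates of [equivariant_lower]. *)
Lemma highest_hom U : exists H : {vspace {ffun low_type -> k^o}},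
  forall c : {ffun low_type -> k^o},
  c \in H <-> (forall x, highest x -> \sum_b c b *: xi (nat_pair (val b)) x \in U).
Proof.
apply: vspace_of_pred => [x hx|a c d cU dU x hx].
  by rewrite big1 ?mem0v // => b _; rewrite ffunE scale0r.
rewrite (eq_bigr (fun b => a *: (c b *: xi (nat_pair (val b)) x) + d b *: xi (nat_pair (val b)) x)).
  by rewrite big_split -scaler_sumr memvD ?memvZ ?cU ?dU.
by move=> b _; rewrite !ffunE scalerDl scalerA.
Qed.

(** Let [e] be the projection onto a complement of [U] in [U']. Some [r] carries it nontrivially to
    highest weight vectors, and [e s], with [s] a generalized inverse of [r e], leads back to [U'];
    this is the map sought. *)
Lemma highest_hom_strict U U' : stable rho U -> stable rho U' -> (U <= U')%VS -> ~~ (U' <= U)%VS ->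
  exists2 c : {ffun low_type -> k^o},
    forall x, highest x -> \sum_b c b *: xi (nat_pair (val b)) x \in U' &
    exists2 x, highest x & \sum_b c b *: xi (nat_pair (val b)) x \notin U.
Proof.
move=> sU sU' UU' /subvPn [x0 x0U' x0U].
have [e [ee eU' ediff eU eK]] := equivariant_quot (@rho1 _ _ _) (@rhoM _ _ _) card_perm_neq0 sU sU' UU'.
have e0 : e != 0.
  by apply: contraNneq x0U => e0; have := ediff _ x0U'; rewrite e0 lfunE subr0.
have [r [mu [er re0 reh _]]] := highest_exists ee e0.
have ere := equivariant_comp er ee.
have [s es sK] := equivariant_inverse (@rho1 _ _ _) (@rhoM _ _ _) card_perm_neq0 ere.
have [c cE] := equivariant_lower (equivariant_comp ee es).
exists [ffun b => c b] => [x hx|].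
  under eq_bigr do rewrite ffunE.
  by rewrite -cE // comp_lfunE eU'.
have [x rex] : exists x, (r \o e)%VF x != 0.
  apply: contrapT => H; move/eqP: re0; apply; apply/lfunP => x; rewrite [RHS]lfunE.
  by apply: contrapT => /eqP rex; apply: H; exists x.
exists ((r \o e)%VF x) => //; under eq_bigr do rewrite ffunE.
(* If [e s r e x] were in [U], the idempotent [e] would kill it, and then
   [r e x = r e s r e x = 0]. *)
rewrite -cE //; apply: contra rex => /eU; rewrite !comp_lfunE eK => E.
by have /lfunP/(_ x) := sK; rewrite !comp_lfunE E linear0 => <-.
Qed.

Lemma sum_steps_le (h : nat -> nat) (d : nat -> bool) l :
  (forall i, (i < l)%N -> (h i + d i <= h i.+1)%N) -> (\sum_(i < l) d i <= h l)%N.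
Proof.
elim: l => [|l IH] H; first by rewrite big_ord0.
rewrite big_ord_recr /=; apply: leq_trans (H l _); rewrite ?leq_add2r // IH // => i il.
by apply: H; apply: ltnW.
Qed.

(** The dimension of the space [H i] of maps into [U i] grows at each strict step. Equal steps are
    allowed because a chain of graded subobjects may stall in a given degree. *)
Lemma chain_upper (U : nat -> {vspace wordfun}) l : (forall i, stable rho (U i)) ->
  (forall i, (i < l)%N -> (U i <= U i.+1)%VS) ->
  (\sum_(i < l) ~~ (U i.+1 <= U i)%VS <= #|low_type|)%N.
Proof.
move=> sU UU; have /boolp.choice [H HE] := fun i => highest_hom (U i).
apply: leq_trans (_ : \dim (H l) <= _)%N; last first.
  apply: leq_trans (dimvS (subvf _)) _.
  by rewrite dimvf /dim /= muln1.
apply: (@sum_steps_le (fun i => \dim (H i)) (fun i => ~~ (U i.+1 <= U i)%VS)) => i il.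
have sub : (H i <= H i.+1)%VS.
  by apply/subvP => c /HE cU; apply/HE => x hx; apply: subvP (UU i il) _ (cU x hx).
case: (boolP (U i.+1 <= U i)%VS) => [_|nU] /=; first by rewrite addn0 dimvS.
rewrite addn1 ltn_neqAle dimvS // andbT.
have [c /HE cU' [x hx cU]] := highest_hom_strict (sU i) (sU i.+1) (UU i il) nU.
apply/negP => /eqP dE; have E : H i = H i.+1 by apply/eqP; rewrite eqEdim sub dE /=.
by move: cU'; rewrite -E => /HE /(_ x hx); apply/negP.
Qed.

Definition column mu (b : low_type) : bool := [forall q, \sum_l val b (l, q) == mu q :> nat]%N.
Definition low_content (mu : {ffun 'I_n -> nat}) : finType := {b : low_type | column mu b}.

(** The column sums of the type of [(w, v)] form the content of [v]. *)
Lemma xi_content mu x (b : low_type) : has_content mu x -> ~~ column mu b ->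
  xi (nat_pair (val b)) x = 0.
Proof.
move=> xmu bmu; apply/ffunP => w; rewrite xiE [RHS]ffunE big1 // => v /eqP wv.
apply: xmu; apply: contra bmu => /eqP <-; apply/forallP => q; rewrite -(pair_type_column w) wv.
by apply/eqP; apply: eq_bigr => l _; rewrite ffunE.
Qed.

(** The entries strictly below the diagonal suffice: those above are 0, and the column sums give
    back the diagonal. *)
Lemma card_low_content mu : (#|low_content mu| <= j.+1 ^ 'C(n, 2))%N.
Proof.
pose lowpos : finType := {c : 'I_n * 'I_n | (c.2 < c.1)%N}.
pose f (b : low_content mu) : {ffun lowpos -> 'I_j.+1} := [ffun c => val (val b) (val c)].
have f_inj : injective f.
  move=> b b' /ffunP fE; apply: val_inj; apply: val_inj; apply: nat_pair_inj.
  have off p q : p != q -> nat_pair (val (val b)) (p, q) = nat_pair (val (val b')) (p, q).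
    rewrite neq_ltn => /orP [] pq.
      have low0 (d : low_content mu) : nat_pair (val (val d)) (p, q) = 0%N.
        by have /andP [_ /forallP/(_ (p, q))/implyP/(_ pq)/eqP] := valP (val d).
      by rewrite !low0.
    have := fE (Sub (p, q) pq); rewrite !ffunE SubK => E.
    by rewrite E.
  apply/ffunP => -[p q]; have [->|/off //] := eqVneq p q.
  have := forallP (valP b) q; rewrite -(eqP (forallP (valP b') q)) => /eqP.
  rewrite (bigD1 q) //= [in RHS](bigD1 q) //=.
  rewrite (eq_bigr (fun l => val (val b') (l, q) : nat)) => [|l lq]; last first.
    by have := off _ _ lq; rewrite !ffunE.
  by move/addIn; rewrite !ffunE.
apply: leq_trans (leq_card f f_inj) _.
by rewrite card_ffun card_ord /lowpos /= card_sig card_below.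
Qed.

(* G and G' are Hom(M/U, M) and Hom(M/U', M) in the coordinates of [full_op].
   By simplicity U'/U embeds into the highest weight vectors of some content mu. *)
Lemma simple_step U U' (m := (j.+1 ^ 'C(n, 2))%N) : stable rho U -> stable rho U' ->
  (U <= U')%VS -> ~~ (U' <= U)%VS ->
  (forall Z, stable rho Z -> (U <= Z)%VS -> (Z <= U')%VS -> (Z <= U)%VS \/ (U' <= Z)%VS) ->
  forall G G' : {vspace {ffun full_type -> k^o}},
  (forall c, c \in G <-> (forall x, x \in U -> full_op c x = 0)) ->
  (forall c, c \in G' <-> (forall x, x \in U' -> full_op c x = 0)) ->
  (\dim G <= \dim G' + m)%N.
Proof.
move=> sU sU' UU' nU simple G G' GE GE'.
have [e [ee eU' ediff eU eK]] := equivariant_quot (@rho1 _ _ _) (@rhoM _ _ _) card_perm_neq0 sU sU' UU'.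
have e0 : e != 0.
  have /subvPn [x0 x0U' x0U] := nU.
  by apply: contraNneq x0U => e0; have := ediff _ x0U'; rewrite e0 lfunE subr0.
have [r [mu [er re0 reh remu]]] := highest_exists ee e0.
have ere := equivariant_comp er ee.
have [s es sK] := equivariant_inverse (@rho1 _ _ _) (@rhoM _ _ _) card_perm_neq0 ere.
have reK x : r (e (s (r (e x)))) = r (e x) by have /lfunP/(_ x) := sK; rewrite !comp_lfunE.
(* By simplicity [r] is injective on the image of [e]: the part of [U'] killed by [r e] contains
   [U], and it is not all of [U'] since [r e] is nonzero. *)
have esre x : e (s (r (e x))) = e x.
  pose Z := (lker (r \o e) :&: U')%VS.
  have sZ : stable rho Z.
    move=> g y; rewrite !memv_cap !memv_ker => /andP [/eqP ry yU'].
    by rewrite sU' // andbT -(equivariantE ere) ry linear0.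
  have UZ : (U <= Z)%VS.
    apply/subvP => y yU; rewrite memv_cap memv_ker (subvP UU') // andbT.
    by rewrite comp_lfunE eU // linear0.
  case: (simple Z sZ UZ (capvSr _ _)) => [ZU|/subvP U'Z].
    have /eU : e (s (r (e x)) - x) \in U.
      apply: (subvP ZU); rewrite memv_cap memv_ker eU' andbT.
      by rewrite comp_lfunE eK !linearB /= reK subrr.
    by rewrite eK linearB => /eqP; rewrite subr_eq0 => /eqP.
  case/eqP: re0; apply/lfunP => y.
  have := U'Z _ (eU' y); rewrite memv_cap memv_ker => /andP [/eqP].
  by rewrite !comp_lfunE eK lfunE.
have PhiL : linear (fun c => full_op c \o e)%VF.
  by move=> a c d; rewrite full_op_linear comp_lfunDl comp_lfunZl.
pose Phi := linfun (mklin PhiL).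
have PhiE c : Phi c = (full_op c \o e)%VF by rewrite lfunE /= mklinE.
(* [Phi] restricts to the complement of [U] in [U']. Its kernel on [G] lies in [G'], so only the
   dimension of its image remains to be bounded. *)
rewrite -(limg_ker_dim Phi G) leq_add //.
  apply: dimvS; apply/subvP => c; rewrite memv_cap memv_ker PhiE => /andP [/GE cU /eqP /lfunP cE].
  apply/GE' => x xU'; have := cE x; rewrite comp_lfunE [RHS]lfunE /= => ex.
  by rewrite -[x](subrK (e x)) linearD /= ex addr0 cU // ediff.
pose X := [seq (xi (nat_pair (val b)) \o (r \o e))%VF | b in [pred b | column mu b]].
have XE : (Phi @: G <= <<X>>)%VS.
  apply/subvP => _ /memv_imgP [c _ ->]; rewrite PhiE.
  have efull : equivariant rho (full_op c).
    move=> g; apply/lfunP => x; rewrite !comp_lfunE !sum_lfunE linear_sum.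
    by apply: eq_bigr => b _; rewrite !scale_lfunE linearZ /= (equivariantE (xi_equivariant _)).
  (* Factor [full_op c e] as [(full_op c e s) (r e)] and expand the first factor on the highest
     weight vectors [r e x], where content [mu] leaves only the [b] with column sums [mu]. *)
  have [d dE] := equivariant_lower (equivariant_comp efull (equivariant_comp ee es)).
  have -> : (full_op c \o e)%VF =
      \sum_(b | column mu b) d b *: (xi (nat_pair (val b)) \o (r \o e))%VF.
    apply/lfunP => x; have := dE _ (reh x).
    rewrite !comp_lfunE esre => ->; rewrite sum_lfunE.
    rewrite (bigID (column mu)) /= [X in _ + X]big1 ?addr0 => [|b bmu]; last first.
      by have := xi_content (remu x) bmu; rewrite comp_lfunE => ->; rewrite scaler0.
    by apply: eq_bigr => b _; rewrite scale_lfunE !comp_lfunE.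
  by apply: memv_suml => b bmu; rewrite memvZ // memv_span //; apply/mapP; exists b; rewrite ?mem_enum.
apply: leq_trans (dimvS XE) _; apply: leq_trans (dim_span _) _.
by rewrite size_map -cardE -card_sig card_low_content.
Qed.

Lemma vanishing U : exists G : {vspace {ffun full_type -> k^o}},
  forall c, c \in G <-> (forall x, x \in U -> full_op c x = 0).
Proof.
apply: vspace_of_pred => [x _|a c d cU dU x xU].
  by rewrite /full_op big1 ?lfunE // => b _; rewrite ffunE scale0r.
by rewrite full_op_linear add_lfunE scale_lfunE cU // dU // scaler0 addr0.
Qed.

(** The endomorphisms vanishing on [U i] filter the Schur algebra, from everything at [i = 0] down
    to 0 at [i = l]; [simple_step] bounds the loss at each strict step. *)
Lemma chain_lower (U : nat -> {vspace wordfun}) l : (forall i, stable rho (U i)) ->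
  U 0%N = 0%VS -> U l = fullv ->
  (forall i, (i < l)%N -> (U i <= U i.+1)%VS) ->
  (forall i, (i < l)%N -> ~~ (U i.+1 <= U i)%VS -> forall Z, stable rho Z ->
     (U i <= Z)%VS -> (Z <= U i.+1)%VS -> (Z <= U i)%VS \/ (U i.+1 <= Z)%VS) ->
  (#|full_type| <= (\sum_(i < l) ~~ (U i.+1 <= U i)%VS) * j.+1 ^ 'C(n, 2))%N.
Proof.
move=> sU U0 Ul UU simple; have /boolp.choice [G GE] := fun i => vanishing (U i).
have dG0 : \dim (G 0%N) = #|full_type|.
  have -> : G 0%N = fullv.
    apply/vspaceP => c; rewrite memvf; apply/GE => x.
    by rewrite U0 memv0 => /eqP ->; rewrite linear0.
  by rewrite dimvf /dim /= muln1.
have dGl : \dim (G l) = 0%N.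
  apply/eqP; rewrite dimv_eq0 -subv0; apply/subvP => c /GE; rewrite Ul memv0 => cU.
  apply/eqP/full_op_inj/lfunP => x; rewrite cU ?memvf // /full_op big1 ?lfunE // => b _.
  by rewrite ffunE scale0r.
have step i : (i < l)%N ->
    (\dim (G i) <= \dim (G i.+1) + ~~ (U i.+1 <= U i)%VS * j.+1 ^ 'C(n, 2))%N.
  move=> il; case: (boolP (U i.+1 <= U i)%VS) => [UU'|nU].
    rewrite addn0; apply/dimvS/subvP => c /GE cU; apply/GE => x xU.
    by apply: cU; apply: (subvP UU').
  rewrite mul1n; exact: (simple_step (sU i) (sU i.+1) (UU i il) nU (simple i il nU) (GE i) (GE i.+1)).
have H m : (m <= l)%N -> (\dim (G 0%N) <= \dim (G m) +
    (\sum_(i < m) ~~ (U i.+1 <= U i)%VS) * j.+1 ^ 'C(n, 2))%N.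
  elim: m => [|m IH] ml; first by rewrite big_ord0 addn0.
  apply: leq_trans (IH (ltnW ml)) _; rewrite big_ord_recr /= mulnDl [in X in (_ <= X)%N]addnCA addnC.
  by rewrite leq_add2l step.
by have := H l (leqnn l); rewrite dG0 dGl.
Qed.

End Chains.

(** * Chains of graded subobjects *)

Section Subreps.
Context (k : fieldType) (X : symrep k).
Implicit Types (U V Z : subrep X).

Definition zerorep : subrep X.
Proof.
refine (@SubRep k X (fun n x => x = 0) _ _ _) => [n //|n a x y -> ->|n s x ->].
  by rewrite scaler0 addr0.
by rewrite /= linear0.
Defined.

(** Degrees are independent of each other, so a subobject can be changed in one degree alone. Such
    subobjects show that a simple quotient lives in a single degree. *)
Lemma splice_subproof U V (j : nat) : exists Z : subrep X,
  (forall x, Z j x <-> U j x) /\ (forall n x, n != j -> Z n x <-> V n x).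
Proof.
pose S n : set (X n) := if n == j then U n else V n.
have S0 n : S n 0 by rewrite /S; case: eqP => _; exact: subrep0.
have SP n a (x y : X n) : S n x -> S n y -> S n (a *: x + y).
  by rewrite /S; case: eqP => _; exact: subrepP.
have SA n (s : 'S_n) x : S n x -> S n (act s x).
  by rewrite /S; case: eqP => _; exact: subrep_act.
exists (SubRep S0 SP SA); split=> [x|n x /negPf nj]; rewrite /= /S ?eqxx //.
by rewrite nj.
Qed.
Definition splice U V j := projT1 (cid (splice_subproof U V j)).
Lemma splice_eq U V j x : splice U V j j x <-> U j x.
Proof. by rewrite /splice; case: cid => Z [/= + _]; apply. Qed.
Lemma splice_neq U V j n x : n != j -> splice U V j n x <-> V n x.
Proof. by rewrite /splice; case: cid => Z [/= _ +]; apply. Qed.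

Lemma subrep_in_degree (j : nat) (P : X j -> Prop) : P 0 ->
  (forall a x y, P x -> P y -> P (a *: x + y)) ->
  (forall s x, P x -> P (act s x)) -> exists Z : subrep X, forall x, Z j x <-> P x.
Proof.
move=> P0 PP PA.
(* Outside degree [j] there is no [E], so the subobject is everything there; [splice] can then
   replace those degrees. *)
pose S n : set (X n) := fun x => forall E : n = j, P (eq_rect n (fun d => X d) x j E).
have S0 n : S n 0 by move=> E; case: j / E P P0 PP PA @S.
have SP n a (x y : X n) : S n x -> S n y -> S n (a *: x + y).
  move=> + + E; case: j / E P P0 PP PA @S S0 => P P0 PP PA S S0 Sx Sy /=.
  exact: PP (Sx erefl) (Sy erefl).
have SA n (s : 'S_n) x : S n x -> S n (act s x).
  move=> + E; case: j / E P P0 PP PA @S S0 SP => P P0 PP PA S S0 SP Sx /=.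
  exact: PA (Sx erefl).
exists (SubRep S0 SP SA) => x; split=> [/(_ erefl)//|Px E].
by rewrite (eq_irrelevance E erefl).
Qed.

Definition strict_chain (c : nat -> subrep X) l : Prop :=
  forall i, (i < l)%N -> subrep_le (c i) (c i.+1) /\ ~ subrep_le (c i.+1) (c i).

Lemma subrep_le_trans V U Z : subrep_le U V -> subrep_le V Z -> subrep_le U Z.
Proof. by move=> UV VZ n x /UV /VZ. Qed.

Lemma chain_le c l : strict_chain c l -> forall i m, (i <= m <= l)%N -> subrep_le (c i) (c m).
Proof.
move=> cs i m; elim: m => [|m IH] /andP [im ml].
  by move: im; rewrite leqn0 => /eqP -> n x.
move: im; rewrite leq_eqVlt => /orP [/eqP -> //|im].
by apply: subrep_le_trans (proj1 (cs m ml)); apply: IH; rewrite -ltnS im ltnW.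
Qed.

(* A strict chain of maximal length is a composition series. *)
Lemma length_exists U B :
  (forall c l, strict_chain c l -> subrep_le (c l) U -> (l <= B)%N) ->
  exists2 l, has_length U l & (l <= B)%N.
Proof.
move=> bound.
pose d l := `[< exists c, strict_chain c l /\ subrep_le (c l) U >].
have ex : exists l, d l.
  by exists 0%N; apply/asboolP; exists (fun=> U); split=> [i|n x]; rewrite ?ltn0.
have ub l : d l -> (l <= B)%N by move=> /asboolP [c [cs cU]]; apply: bound cs cU.
case: (ex_maxnP ex ub) => l /asboolP [c [cs cU]] max.
(* Inserting [Z] at place [p] would give a longer chain. There is no upper neighbour for [p = l.+1]
   and no lower one for [p = 0]. *)
have insert p Z : (p <= l.+1)%N -> ((p < l.+1)%N -> subrep_le Z (c p) /\ ~ subrep_le (c p) Z) ->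
    ((0 < p)%N -> subrep_le (c p.-1) Z /\ ~ subrep_le Z (c p.-1)) -> subrep_le Z U -> False.
  move=> pl Zp pZ ZU.
  suff : d l.+1 by move/max; rewrite ltnn.
  apply/asboolP; exists (fun t => if (t < p)%N then c t else if t == p then Z else c t.-1).
  split=> [i il|]; last first.
    by rewrite ltnNge pl /=; case: eqP => // _; apply: cU.
  have [ip|p_i] := ltnP i p.
    have [ip'|p_i'] := ltnP i.+1 p.
      by apply: cs; lia.
    have E : i.+1 = p by apply/eqP; rewrite eqn_leq ip p_i'.
    by rewrite E eqxx; have := pZ; rewrite -E /=; apply.
  rewrite ltnNge (leqW p_i) /= (gtn_eqF (p_i : (p < i.+1)%N)) /=.
  case: eqP => [E|/eqP ne]; first by move: il; rewrite E; apply: Zp.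
  have ip : (p < i)%N by rewrite ltn_neqAle eq_sym ne.
  by case: i ip il {p_i ne} => // i ip il; apply: cs.
exists l; last by apply: bound cs cU.
(* Three insertions are excluded: zero below [c 0], [U] above [c l], and a [Z] strictly between
   [c i] and [c i.+1]. *)
exists c; split=> [n x c0x||i il].
- apply: contrapT => x0; apply: (insert 0%N zerorep) => //; last by move=> ? ? ->; exact: subrep0.
  move=> _; split; first by move=> ? ? ->; exact: subrep0.
  by move=> /(_ n x c0x).
- split=> //; apply: contrapT => nU; apply: (insert l.+1 U) => //; first by rewrite ltnn.
- split=> [||Z iZ Zi]; [exact: (proj1 (cs i il))|exact: (proj2 (cs i il))|].
  apply: contrapT => nZ; apply: (insert i.+1 Z) => //=.
  + by rewrite ltnS; apply: ltnW.
  + by move=> _; split=> // iZ'; apply: nZ; right.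
  + by move=> _; split=> // iZ'; apply: nZ; left.
  + apply: subrep_le_trans Zi _; apply: subrep_le_trans cU; apply: (chain_le cs).
    by rewrite il leqnn.
Qed.

(** Each of the finitely many simple steps changes only one degree. *)
Lemma has_length_bounded_degree U l : has_length U l ->
  exists d, forall n x, (d < n)%N -> U n x -> x = 0.
Proof.
case=> c [c0 [_ Uc] cs].
suff H i : (i <= l)%N -> exists d, forall n x, (d < n)%N -> c i n x -> x = 0.
  by have [d dP] := H l (leqnn l); exists d => n x dn /Uc; apply: dP.
elim: i => [|i IH] il; first by exists 0%N => n x _; apply: c0.
have [d dP] := IH (ltnW il); have [ii nii simple] := cs i il.
have [j [y [cy ncy]]] : exists j y, c i.+1 j y /\ ~ c i j y.
  apply: contrapT => H; apply: nii => j y cy; apply: contrapT => ncy; apply: H.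
  by exists j, y.
exists (maxn d j) => n x; rewrite gtn_max => /andP [dn jn] cx; apply: (dP n) => //.
case: (simple (splice (c i.+1) (c i) j)).
- move=> m z cz; have [mj|mj] := eqVneq m j; last exact/splice_neq.
  by subst m; apply/splice_eq/ii.
- move=> m z; have [mj|mj] := eqVneq m j; last by move/(splice_neq _ _ _ mj)/ii.
  by subst m => /splice_eq.
- by move=> /(_ j y) H; case: ncy; apply: H; apply/splice_eq.
- by move=> /(_ n x cx) /splice_neq; apply; rewrite gtn_eqF.
Qed.
End Subreps.

(** * Tensors in coordinates, and the length of graded subobjects of T(W) *)

Section TensorWords.
Context (k : fieldType) (W : vectType k).
Local Notation n := (\dim {:W}).
Local Notation wordfun := (wordfun k n).
Local Notation T := (tensor_rep W).
Local Notation e := (vbasis {:W}).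

Section Degree.
Context (j : nat).

Definition coord_fun (w : 'I_j -> W) : wordfun j := [ffun v : word n j => \prod_i coord e (v i) (w i)].
Lemma coord_multilinear : multilinear coord_fun.
Proof.
move=> w i a x y; apply/ffunP => v; rewrite !ffunE.
have E z : \prod_i' coord e (v i') (update w i z i') =
    coord e (v i) z * \prod_(i' | i' != i) coord e (v i') (w i').
  rewrite (bigD1 i) //= /update eqxx; congr (_ * _).
  by apply: eq_bigr => i' /negPf ->.
by rewrite !E linearP mulrDl -mulrA.
Qed.
Definition coords : {linear T j -> wordfun j} := plift coord_multilinear.
Lemma coordsE w v : coords (tgen w) v = \prod_i coord e (v i) (w i).
Proof. by rewrite [coords _]plift_gen ffunE. Qed.

Definition basis_tensor (v : word n j) : T j := tgen (fun i => e`_(v i)).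
Definition uncoords (x : wordfun j) : T j := \sum_v x v *: basis_tensor v.
Lemma uncoords_linear : linear uncoords.
Proof.
move=> a x y; rewrite /uncoords scaler_sumr -big_split; apply: eq_bigr => v _.
by rewrite !ffunE scalerDl scalerA.
Qed.

Lemma coords_basis v : coords (basis_tensor v) = delta k v.
Proof.
apply/ffunP => u; rewrite coordsE ffunE.
under eq_bigr do rewrite (coord_free _ _ (basis_free (vbasisP _))).
have [->|uv] := eqVneq u v; first by rewrite big1 // => i _; rewrite eqxx.
have [i ui] : exists i, u i != v i.
  apply: contrapT => H; case/eqP: uv; apply/ffunP => i; apply: contrapT => /eqP ui.
  by apply: H; exists i.
by rewrite (bigD1 i) //= eq_sym (negPf ui) mul0r.
Qed.

Lemma uncoordsK : cancel uncoords coords.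
Proof.
move=> x; rewrite /uncoords linear_sum [RHS]wordfun_sum; apply: eq_bigr => v _.
by rewrite linearZ /= coords_basis.
Qed.

(** Tensors of basis vectors span: factors outside the basis are expanded one at a time, by
    induction on their number. *)
Lemma coordsK : cancel coords uncoords.
Proof.
have L : linear (uncoords \o coords) by move=> a x y /=; rewrite linearP uncoords_linear.
apply: (tensor_ext (h := idfun) L) => // w /=.
pose bad (w : 'I_j -> W) := [pred i | w i \notin (e : seq W)].
move: {2}#|bad w| (leqnn #|bad w|) => N; elim: N w => [|N IH] w bw.
  have we i : w i \in (e : seq W).
    by apply: contrapT => /negP wi; move: bw; rewrite leqn0 => /eqP/card0_eq/(_ i); rewrite inE wi.
  have wv i : (index (w i) e < n)%N by rewrite -[X in (_ < X)%N](size_tuple e) index_mem.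
  have -> : tgen w = basis_tensor [ffun i => Ordinal (wv i)].
    by congr tgen; apply: funext => i; rewrite ffunE nth_index.
  rewrite coords_basis /uncoords (bigD1 [ffun i => Ordinal (wv i)]) //= ffunE eqxx scale1r.
  by rewrite big1 ?addr0 // => v /negPf vw; rewrite ffunE vw scale0r.
have [/eqP b0|] := posnP #|bad w|; first by apply: IH; rewrite (eqP b0).
case/card_gt0P => i bi.
have upd0 : w = update w i (w i).
  by apply: funext => i'; rewrite /update; case: eqP => [->|].
have lin1 : linear (fun x => tgen (update w i x)) by exact: tgenL.
have lin2 : linear (fun x => (uncoords \o coords) (tgen (update w i x))).
  by move=> a x y; rewrite lin1 L.
rewrite upd0 (coord_vbasis (memvf (w i))).
rewrite -[RHS](mklinE lin1) -[LHS](mklinE lin2) !linear_sum; apply: eq_bigr => q _.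
rewrite !linearZ /=; congr (_ *: _); rewrite (mklinE lin1) (mklinE lin2); apply: IH.
rewrite -ltnS; apply: leq_trans bw; apply: proper_card; apply/properP; split.
  apply/fintype.subsetP => i'; rewrite !inE /update; case: eqP => [->|//].
  by rewrite mem_nth // size_tuple.
by exists i; rewrite // inE /update eqxx negbK mem_nth // size_tuple.
Qed.

Lemma coords_act (s : 'S_j) x : coords (act s x) = @rho k n j s (coords x).
Proof.
move: x; apply: tensor_ext => [a x y|a x y|w]; rewrite ?linearP //.
rewrite [act s _]tactE; apply/ffunP => v; rewrite rhoE !coordsE (reindex_inj (@perm_inj _ s)).
by apply: eq_bigr => i _; rewrite ffunE /tperm_fun permK.
Qed.

Lemma uncoords_act (s : 'S_j) x : uncoords (@rho k n j s x) = act s (uncoords x).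
Proof. by rewrite -[RHS]coordsK coords_act uncoordsK. Qed.

Lemma subrep_vspace (c : subrep T) : exists U : {vspace wordfun j},
  stable (@rho k n j) U /\ forall x, x \in U <-> c j (uncoords x).
Proof.
have [||U UE] := @vspace_of_pred k _ (fun x : wordfun j => c j (uncoords x)).
- have -> : uncoords 0 = 0 by rewrite -(mklinE uncoords_linear) linear0.
  exact: subrep0.
- by move=> a x y cx cy; rewrite uncoords_linear; apply: subrepP.
exists U; split=> // s x /UE cx; apply/UE; rewrite uncoords_act; exact: subrep_act.
Qed.

End Degree.

Definition degree_space (c : subrep T) j : {vspace wordfun j} :=
  projT1 (cid (subrep_vspace j c)).
Lemma degree_space_stable c j : stable (@rho k n j) (degree_space c j).
Proof. by rewrite /degree_space; case: cid => U []. Qed.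
Lemma degree_spaceE c j x : x \in degree_space c j <-> c j (uncoords x).
Proof. by rewrite /degree_space; case: cid => U []. Qed.

Lemma degree_space_le c d j :
  (degree_space c j <= degree_space d j)%VS <-> (forall x, c j x -> d j x).
Proof.
split=> [/subvP cd x cx|cd]; last by apply/subvP => x /degree_spaceE/cd/degree_spaceE.
rewrite -(coordsK x); apply/degree_spaceE/cd/degree_spaceE.
by rewrite coordsK.
Qed.

Hypothesis char0 : [pchar k] =i pred0.

(** Every step is strict in at least one degree up to [D], and [chain_upper] bounds the strict steps
    in each degree. *)
Lemma tensor_chain_bound (c : nat -> subrep T) l D : strict_chain c l ->
  (forall j x, (D < j)%N -> c l j x -> x = 0) ->
  (l <= \sum_(j < D.+1) #|low_type n j|)%N.
Proof.
move=> cs cD.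
pose strict i j := ~~ (degree_space (c i.+1) j <= degree_space (c i) j)%VS.
have strict_sum i : (i < l)%N -> (1 <= \sum_(j < D.+1) strict i j)%N.
  move=> il; have [_ nle] := cs i il.
  have [j [x [cx ncx]]] : exists j x, c i.+1 j x /\ ~ c i j x.
    apply: contrapT => H; apply: nle => j y cy; apply: contrapT => ncy; apply: H.
    by exists j, y.
  have jD : (j < D.+1)%N.
    rewrite ltnS leqNgt; apply/negP => Dj; apply: ncx; rewrite (cD j x) ?Dj //.
      exact: subrep0.
    by apply: (chain_le cs) cx; rewrite il leqnn.
  rewrite (bigD1 (Ordinal jD)) //= (_ : strict i j) //.
  by apply/negP => /degree_space_le /(_ x cx).
have -> : l = (\sum_(i < l) 1)%N by rewrite sum1_card card_ord.
apply: leq_trans (_ : \sum_(i < l) \sum_(j < D.+1) strict i j <= _)%N.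
  by apply: leq_sum => i _; apply: strict_sum.
rewrite exchange_big; apply: leq_sum => j _.
apply: (chain_upper char0 (U := fun i => degree_space (c i) j)) => [i|i il].
  exact: degree_space_stable.
by apply/degree_space_le => x; apply: (proj1 (cs i il)).
Qed.

(** Every step is strict in at most one degree, so the bounds of [chain_lower] in the degrees up to
    [m] add up with the steps counted at most once. *)
Lemma tensor_length_bound (U : subrep T) l m : has_length U l ->
  (forall j x, (j <= m)%N -> U j x) ->
  (\sum_(j < m.+1) #|full_type n j| <= l * m.+1 ^ 'C(n, 2))%N.
Proof.
case=> c [c0 [_ Uc] cs] Um.
pose strict i j := ~~ (degree_space (c i.+1) j <= degree_space (c i) j)%VS.
have strict_one i j j' : (i < l)%N -> strict i j -> strict i j' -> j = j'.
  move=> il sj sj'; apply/eqP; apply: contrapT => /negP jj'.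
  have [ii nii simple] := cs i il.
  (* Enlarging [c i] in degree [j] alone gives an intermediate subobject. It must be one of the two
     ends, which excludes a second strict degree. *)
  case: (simple (splice (c i.+1) (c i) j)).
  - move=> d z cz; have [dj|dj] := eqVneq d j; last exact/splice_neq.
    by subst d; apply/splice_eq/ii.
  - move=> d z; have [dj|dj] := eqVneq d j; last by move/(splice_neq _ _ _ dj)/ii.
    by subst d => /splice_eq.
  - move=> H; move/negP: sj; apply; apply/degree_space_le => x cx.
    by apply: H; apply/splice_eq.
  - move=> H; move/negP: sj'; apply; apply/degree_space_le => x cx.
    by have /splice_neq := H _ _ cx; apply; rewrite eq_sym.
have strict_sum i : (i < l)%N -> (\sum_(j < m.+1) strict i j <= 1)%N.
  move=> il; case: (pickP (fun j : 'I_m.+1 => strict i j)) => [j sj|none].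
    rewrite (bigD1 j) //= sj big1 // => j' /negP jj'.
    case sj' : (strict i j') => //; case: jj'; rewrite -val_eqE /=.
    by rewrite (strict_one i j' j il sj' sj).
  by rewrite big1 // => j _; rewrite none.
have bound (j : 'I_m.+1) :
    (#|full_type n j| <= (\sum_(i < l) strict i j) * m.+1 ^ 'C(n, 2))%N.
  apply: leq_trans (_ : (\sum_(i < l) strict i j) * j.+1 ^ 'C(n, 2) <= _)%N; last first.
    by rewrite leq_mul2l; case: 'C(n, 2) => [|r]; rewrite ?leqnn ?leq_exp2r ?(ltn_ord j) ?orbT.
  apply: (chain_lower char0 (U := fun i => degree_space (c i) j)) => [i|||i il|i il sij Z sZ iZ Zi].
  - exact: degree_space_stable.
  - apply/eqP; rewrite -subv0; apply/subvP => x /degree_spaceE /c0 x0; rewrite memv0.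
    by rewrite -(uncoordsK x) x0 linear0.
  - apply/vspaceP => x; rewrite memvf; apply/degree_spaceE/Uc; apply: Um.
    by rewrite -ltnS.
  - by apply/degree_space_le => x; have [ii _ _] := cs i il; apply: ii.
  have [ii nii simple] := cs i il.
  (* A stable space between the two degree [j] parts extends to a graded subobject between [c i] and
     [c i.+1], so simplicity holds within degree [j]. *)
  have [|||Y YE] := @subrep_in_degree k T j (fun x : T j => coords j x \in Z).
  - by rewrite linear0 mem0v.
  - by move=> a x y xZ yZ; rewrite linearP memvD ?memvZ.
  - by move=> s x xZ; rewrite coords_act sZ.
  case: (simple (splice Y (c i) j)).
  - move=> d z cz; have [dj|dj] := eqVneq d j; last exact/splice_neq.
    subst d; apply/splice_eq/YE; apply: (subvP iZ); apply/degree_spaceE.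
    by rewrite coordsK.
  - move=> d z; have [dj|dj] := eqVneq d j; last by move/(splice_neq _ _ _ dj)/ii.
    subst d => /splice_eq/YE/(subvP Zi)/degree_spaceE.
    by rewrite coordsK.
  - move=> H; left; apply/subvP => x xZ; apply/degree_spaceE/H/splice_eq/YE.
    by rewrite uncoordsK.
  - move=> H; right; apply/subvP => x /degree_spaceE/H/splice_eq/YE.
    by rewrite uncoordsK.
apply: leq_trans (_ : \sum_(j < m.+1) (\sum_(i < l) strict i j) * m.+1 ^ 'C(n, 2) <= _)%N.
  by apply: leq_sum.
rewrite -big_distrl leq_mul2r exchange_big; apply/orP; right.
rewrite -[X in (_ <= X)%N](card_ord l) -sum1_card; apply: leq_sum => i _.
exact: strict_sum.
Qed.
End TensorWords.

(** * The image of the symmetric powers *)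

Section TensorGrowth.
Context (k : fieldType) (W : vectType k).
Local Notation T := (tensor_rep W).
Local Notation A := (tensor_algebra W).

Lemma tensor0_scalar (t : T 0%N) : exists c, t = c *: tgen (fun=> 0).
Proof.
move: t; apply: pres_ind => [|a g y [c ->]]; first by exists 0; rewrite scale0r.
exists (a + c); rewrite scalerDl; congr (_ *: _ + _).
by congr tgen; apply: funext => -[].
Qed.

Lemma tmul1l (E : (0 + 1 = 1)%N) (w : 'I_0 -> W) (t : T 1%N) : tmul E (tgen w) t = t.
Proof.
move: t; apply: (tensor_ext (h := idfun)) => [a x y|a x y|w'] //; first by rewrite tmulR.
rewrite tmulE; congr tgen; apply: (eq_conc (E := E)) => -[[]//|z].
by rewrite conc_place; congr w'; apply: val_inj; rewrite val_place.
Qed.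

Lemma tmul1r (E : (1 + 0 = 1)%N) (w : 'I_0 -> W) (t : T 1%N) : tmul E t (tgen w) = t.
Proof.
move: t; apply: (tensor_ext (h := idfun)) => [a x y|a x y|w'] //; first by rewrite tmulL.
rewrite tmulE; congr tgen; apply: (eq_conc (E := E)) => -[z|[]//].
by rewrite conc_place; congr w'; apply: val_inj; rewrite val_place.
Qed.

Context (V : symrep k) (f : symhom V A).

Lemma tpow_map_pt i n p q (E : (p + q = n)%N) g (x : V p) (u : tpow V i q) :
  tpow_map f i.+1 n (pt E g x u) = act g (tmul E (f p x) (tpow_map f i q u) : T n).
Proof.
rewrite -[LHS]/(tensor_mul W n (dayhom f (tpow_map f i) n _)) dayhomE.
exact: tensor_mulE.
Qed.

(** A nonzero product of [i] elements of degree at most [d] has degree at most [d * i]. *)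
Lemma tpow_map_high d i n u : (forall n (x : V n), (d < n)%N -> x = 0) -> (d * i < n)%N ->
  tpow_map f i n u = 0.
Proof.
move=> Vd; elim: i n u => [|i IH] n u dn.
  case: n u dn => [|n] u; first by rewrite muln0.
  by rewrite -[tpow_map _ _ _ _]/(mklin (@tensor_unitL k W n.+1) u) mklinE.
move: u; apply: (day_ext (h := fun=> 0)) => [a x y|a x y|p q E g x u].
- by rewrite linearP.
- by rewrite scaler0 addr0.
rewrite tpow_map_pt; have [pd|dp] := leqP p d.
  by rewrite IH; [rewrite -(mklinE (tmulR E _)) !linear0|lia].
by rewrite (Vd p x dp) linear0 -(mklinE (tmulL E _)) !linear0.
Qed.

Lemma canon_ind i n (P : A n -> Prop) : P 0 -> (forall a x y, P x -> P y -> P (a *: x + y)) ->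
  (forall u, P (tpow_map f i n u)) -> forall u, P (canon f i n u).
Proof.
move=> P0 PP Pu; apply: pres_ind => [|a v u IH]; first by rewrite linear0.
rewrite linearP; apply: PP => //.
have -> : gen (@sym_invariant k V i n) v = sym_proj V i n v.
  by rewrite [RHS](mklinE (@sym_projL _ _ _ n)).
by rewrite canonE.
Qed.

Lemma canon_image_ind m n (P : A n -> Prop) : P 0 ->
  (forall a x y, P x -> P y -> P (a *: x + y)) ->
  (forall i u, (i <= m)%N -> P (tpow_map f i n u)) -> forall x, canon_image f m n x -> P x.
Proof.
move=> P0 PP Pu x [u _ <-]; rewrite /canon_le; apply: big_ind => // [y z Py Pz|i _].
  by rewrite -[y]scale1r; apply: PP.
by apply: canon_ind => // v; apply: Pu; rewrite -ltnS.
Qed.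

Lemma canon_image_high d m n x : (forall n (x : V n), (d < n)%N -> x = 0) -> (d * m < n)%N ->
  canon_image f m n x -> x = 0.
Proof.
move=> Vd dn; move: x; apply: canon_image_ind => // [a x y -> ->|i u im].
  by rewrite scaler0 addr0.
by apply: tpow_map_high Vd _; apply: leq_ltn_trans dn; rewrite leq_mul2l im orbT.
Qed.

(** In a product of degree 1 one factor has degree 1 and the others are scalars, so products yield
    nothing beyond the image of [V] itself. The empty product contributes 0. *)
Lemma tpow_map_degree1 i u : exists y, tpow_map f i 1 u = f 1%N y.
Proof.
elim: i u => [|i IH] u.
  exists 0; rewrite linear0 -[LHS]/(mklin (@tensor_unitL k W 1) u); exact: mklinE.
move: u; apply: day_ind => [|a p q E g x u v [y vy]]; first by exists 0; rewrite !linear0.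
suff [z zE] : exists z, tpow_map f i.+1 1 (pt E g x u) = f 1%N z.
  by exists (a *: z + y); rewrite [RHS]linearP -vy -zE; exact: linearP.
rewrite tpow_map_pt.
case: p q E x u => [|[|p]] [|[|q]] E x u; try (exfalso; lia).
  have [c ->] := tensor0_scalar (f 0%N x); have [y' ->] := IH u.
  exists (act g (c *: y')); rewrite symhom_act; congr (act g _).
  by rewrite -(mklinE (tmulL E _)) linearZ /= mklinE tmul1l linearZ.
have [c ->] := tensor0_scalar (tpow_map f i 0 u).
exists (act g (c *: x)); rewrite symhom_act; congr (act g _).
by rewrite -(mklinE (tmulR E _)) linearZ /= mklinE tmul1r linearZ.
Qed.

Lemma generates_degree1 : generates f -> forall t : T 1%N, exists y, f 1%N y = t.
Proof.
move=> gen_f t; have [m] := gen_f 1%N t; move: t; apply: canon_image_ind.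
- by exists 0; rewrite linear0.
- by move=> a _ _ [x <-] [y <-]; exists (a *: x + y); rewrite linearP.
- by move=> i u _; have [y ->] := tpow_map_degree1 u; exists y.
Qed.

(** A word is the product of its letters; the first one is split off at each step of the
    induction. *)
Lemma tpow_map_onto : (forall t : T 1%N, exists y, f 1%N y = t) ->
  forall j (w : 'I_j -> W), exists u, tpow_map f j j u = tgen w.
Proof.
move=> onto; elim=> [|j IH] w.
  exists (1 : k^o); rewrite -[LHS]/(mklin (@tensor_unitL k W 0) 1) mklinE /= scale1r.
  by congr tgen; apply: funext => -[].
have [u uE] := IH (fun i => w (lift ord0 i)); have [y yE] := onto (tgen (fun=> w ord0)).
exists (pt (erefl (1 + j)%N) 1%g y u); rewrite tpow_map_pt uE yE Defs.act1.
rewrite [LHS]tmulE; congr tgen; apply: (eq_conc (E := erefl (1 + j)%N)) => s.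
rewrite conc_place; case: s => z; congr w; apply: val_inj; rewrite val_place /=.
  by case: z => -[].
by rewrite /bump.
Qed.

Lemma canon_image_tpow m i n u : (i <= m)%N -> canon_image f m n (tpow_map f i n u).
Proof.
move=> im; have im' : (i < m.+1)%N by [].
exists (@dfwith _ (fun i' : 'I_m.+1 => sym V i' n) (fun=> 0) (Ordinal im') (sym_proj V i n u)) => //.
rewrite /canon_le (bigD1 (Ordinal im')) //= dfwith_in big1 ?addr0 ?canonE // => i' i'i.
by rewrite dfwith_out ?linear0 // eq_sym.
Qed.

Lemma canon_image_low m n x : (forall t : T 1%N, exists y, f 1%N y = t) -> (n <= m)%N ->
  canon_image f m n x.
Proof.
move=> onto nm; move: x; apply: pres_ind => [|a w y IH]; first exact: canon_le0.
apply: canon_leP => //; have [u uE] := tpow_map_onto onto w.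
by rewrite -[gen _ w]uE; apply: canon_image_tpow.
Qed.

Lemma generates_of_degree1 : (forall t : T 1%N, exists y, f 1%N y = t) -> generates f.
Proof. by move=> onto n x; exists n; apply: canon_image_low. Qed.
End TensorGrowth.

(** * A finite length generating subobject: W in degree 1 *)

Section Generators.
Context (k : fieldType) (W : vectType k).

(** This is [W<1>], with ['rV[k]_0] as the zero module in the other degrees. *)
Definition line_mod (n : nat) : lmodType k :=
  match n with 1%N => tensor W 1 | _ => 'rV[k]_0 end.
Definition line_rep : symrep k :=
  @SymRep k line_mod (fun n _ => idfun) (fun n x => erefl) (fun n s t x => erefl).

Definition line_fun n : line_mod n -> tensor W n :=
  match n with 1%N => id | _ => fun=> 0 end.
Lemma line_fun_linear n : linear (@line_fun n).
Proof. by case: n => [|[|n]] a x y //=; rewrite scaler0 addr0. Qed.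
Lemma line_fun_act n (s : 'S_n) (x : line_rep n) :
  mklin (@line_fun_linear n) (act s x) = act s (mklin (@line_fun_linear n) x : tensor_rep W n).
Proof.
rewrite !(mklinE (@line_fun_linear n)); case: n s x => [|[|n]] s x.
- exact: esym (linear0 (tact W s)).
2: exact: esym (linear0 (tact W s)).
have -> : s = 1%g by apply/permP => i; apply: etrans (ord1 _) (esym (ord1 _)).
by rewrite [RHS]Defs.act1.
Qed.
Definition line_incl : symhom line_rep (tensor_algebra W) :=
  @SymHom k line_rep (tensor_algebra W) (fun n => mklin (@line_fun_linear n)) line_fun_act.

Lemma line_mono : mono line_incl.
Proof.
move=> n x y; rewrite /= !(mklinE (@line_fun_linear n)).
by case: n x y => [|[|n]] x y //= _; rewrite (thinmx0 x) (thinmx0 y).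
Qed.

Lemma line_generates : generates line_incl.
Proof. by apply: generates_of_degree1 => t; exists t; rewrite /= mklinE. Qed.

Lemma image_subproof (X Y : symrep k) (f : symhom X Y) (U : subrep X) :
  exists Z : subrep Y, forall n y, Z n y <-> exists2 x, U n x & f n x = y.
Proof.
pose S n : set (Y n) := fun y => exists2 x, U n x & f n x = y.
have S0 n : S n 0 by exists 0; [exact: subrep0|rewrite linear0].
have SP n a x y : S n x -> S n y -> S n (a *: x + y).
  move=> [x' Ux <-] [y' Uy <-]; exists (a *: x' + y'); first exact: subrepP.
  by rewrite linearP.
have SA n (s : 'S_n) y : S n y -> S n (act s y).
  by move=> [x Ux <-]; exists (act s x); [exact: subrep_act|rewrite symhom_act].
by exists (SubRep S0 SP SA).
Qed.

Lemma mono_strict_chain (X Y : symrep k) (f : symhom X Y) c l : mono f -> strict_chain c l ->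
  exists2 c', strict_chain c' l & forall i n y, c' i n y <-> exists2 x, c i n x & f n x = y.
Proof.
move=> mf cs; have /boolp.choice [c' c'E] := fun i => image_subproof f (c i).
exists c' => // i il; have [ii nii] := cs i il; split=> [n y /c'E [x cx <-]|H].
  by apply/c'E; exists x => //; apply: ii.
apply: nii => n x cx; have /H/c'E [x' cx' /mf <-] // : c' i.+1 n (f n x).
by apply/c'E; exists x.
Qed.

(** The inclusion carries strict chains to strict chains of T(W) in degrees at most 1, whose length
    is bounded. *)
Lemma line_finite_length : [pchar k] =i pred0 -> finite_length line_rep.
Proof.
move=> char0.
have [c l cs _|l Hl _] := @length_exists k line_rep (fullrep line_rep)
  (\sum_(j < 2) #|low_type (\dim {:W}) j|); last by exists l.
have [c' cs' c'E] := mono_strict_chain line_mono cs.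
apply: (tensor_chain_bound char0 cs') => -[|[|n]] y // _ /c'E [x _ <-].
by rewrite /= mklinE.
Qed.
End Generators.

(** * Asymptotics *)

Section Counting.
Context (n : nat).

Lemma card_weakly_below : #|[pred c : 'I_n * 'I_n | (c.2 <= c.1)%N]| = 'C(n.+1, 2).
Proof.
rewrite -sum1_card -(pair_big_dep xpredT (fun p q : 'I_n => q <= p)%N (fun _ _ => 1%N)) /=.
rewrite -bin2_sum big_mkord big_ord_recl add0n; apply: eq_bigr => p _.
by rewrite -(big_ord_widen n (fun=> 1%N) (ltn_ord p)) sum1_card card_ord.
Qed.

Lemma sum_card_fibers (I : finType) (P : pred I) (h : I -> nat) m :
  (\sum_(j < m) #|[pred i | P i && (h i == j)]| <= #|P|)%N.
Proof.
under eq_bigr do rewrite -sum1_card.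
rewrite (exchange_big_dep P) /= => [|j i _ /andP [] //].
rewrite -sum1_card; apply: leq_sum => i Pi; rewrite sum1_card.
have [him|mhi] := ltnP (h i) m.
  rewrite (eq_card (B := pred1 (Ordinal him))) ?card1 // => j; rewrite !inE.
  by move: Pi; rewrite unfold_in => ->; rewrite -val_eqE /= eq_sym.
rewrite eq_card0 // => j; rewrite !inE; apply/negP => /andP [_ /eqP E].
by move: (ltn_ord j); rewrite -E ltnNge mhi.
Qed.

(** All these matrices together embed into the functions from the positions on or below the diagonal
    to ['I_D.+1]; [j] is recovered as the sum of the entries. *)
Lemma sum_card_low D : (\sum_(j < D.+1) #|low_type n j| <= D.+1 ^ 'C(n.+1, 2))%N.
Proof.
pose S := pffun_on (ord0 : 'I_D.+1) [pred c : 'I_n * 'I_n | (c.2 <= c.1)%N] predT.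
pose h (g : {ffun 'I_n * 'I_n -> 'I_D.+1}) := (\sum_c g c)%N.
apply: leq_trans (_ : \sum_(j < D.+1) #|[pred g | S g && (h g == j)]| <= _)%N; last first.
  apply: leq_trans (sum_card_fibers _ _ _) _.
  by rewrite card_pffun_on card_weakly_below card_ord.
apply: leq_sum => j _.
pose f (b : low_type n j) : {ffun 'I_n * 'I_n -> 'I_D.+1} := [ffun c => inord (val b c)].
have fE b c : f b c = val b c :> nat.
  by rewrite ffunE inordK //; apply: leq_trans (ltn_ord _) (ltn_ord j).
have f_inj : injective f.
  move=> b b' E; apply: val_inj; apply/ffunP => c; apply: val_inj.
  by rewrite -[LHS]fE E fE.
rewrite -(card_codom f_inj); apply: subset_leq_card; apply/fintype.subsetP => _ /codomP [b ->].
have /andP [tb /forallP lb] := valP b; rewrite inE; apply/andP; split.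
  apply/pffun_onP; split=> //; apply/supportP => -[p q]; rewrite inE /= -ltnNge => pq.
  apply: val_inj; rewrite /= fE; apply/eqP.
  by have /implyP/(_ pq) := lb (p, q); rewrite ffunE.
by rewrite -(eqP tb); apply/eqP/eq_bigr => c _; rewrite fE.
Qed.

(** The matrices with entries at most [t] have sum at most [n * n * t], so all of them are counted
    on the right. *)
Lemma sum_card_full t m : (n * n * t <= m)%N ->
  (t.+1 ^ (n * n) <= \sum_(j < m.+1) #|full_type n j|)%N.
Proof.
move=> ntm; pose B := {ffun 'I_n * 'I_n -> 'I_t.+1}.
pose h (g : B) := (\sum_c g c)%N.
have hm g : (h g < m.+1)%N.
  rewrite ltnS; apply: leq_trans ntm.
  apply: leq_trans (_ : \sum_(c : 'I_n * 'I_n) t <= _)%N.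
    by apply: leq_sum => c _; rewrite -ltnS.
  by rewrite sum_nat_const card_prod card_ord.
have -> : (t.+1 ^ (n * n) = \sum_(j < m.+1) #|[pred g | h g == j]|)%N.
  under eq_bigr do rewrite -sum1_card.
  rewrite (exchange_big_dep predT) //=.
  rewrite -[LHS](_ : #|{: B}| = _); last by rewrite card_ffun card_prod !card_ord.
  rewrite -sum1_card; apply: eq_bigr => g _.
  by rewrite (big_pred1 (Ordinal (hm g))) // => j; rewrite inE /= -val_eqE /= eq_sym.
apply: leq_sum => j _; rewrite -card_sig.
have /boolp.choice [F FE] : forall g : {g : B | h g == j}, exists b : full_type n j,
    nat_pair (val b) = [ffun c => val g c : nat].
  move=> g; have [|b bE tb] := @nat_pairP n j [ffun c => val g c : nat].
    by under eq_bigr do rewrite ffunE; apply/eqP; exact: (valP g).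
  by exists (Sub b tb); rewrite SubK.
apply: (leq_card F) => g g' E; apply: val_inj; apply/ffunP => c; apply: val_inj.
by have /ffunP/(_ c) := FE g; rewrite E FE !ffunE.
Qed.

Lemma bin2D_square : ('C(n.+1, 2) + 'C(n, 2) = n * n)%N.
Proof.
elim: n => [|m IH] //; rewrite !binS !bin1 bin0.
by move: IH; rewrite binS bin1; lia.
Qed.
End Counting.

(** * Growth exponents *)

Section Asymptotics.
Context (R : realType).

Lemma powR_unbounded (K e : R) : 0 < e -> exists t : nat, (0 < t)%N /\ K < t%:R `^ e.
Proof.
(* The maximum with 1 makes the base positive; any [t] above [b] to the power [1 / e] will do. *)
move=> e0; pose b := Num.max K 1.
have b0 : 0 < b by rewrite lt_max ltr01 orbT.
exists (Num.truncn (b `^ e^-1)).+1; split=> //.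
apply: le_lt_trans (_ : b < _); first by rewrite le_max lexx.
rewrite [X in X < _](_ : b = (b `^ e^-1) `^ e); last first.
  by rewrite -powRrM mulVf ?lt0r_neq0 // powRr1 // ltW.
apply: gt0_ltr_powR; rewrite ?nnegrE ?powR_ge0 ?ler0n //.
exact: truncnS_gt.
Qed.

(** For [t > 0], [(a * t).+1] is at most [a.+1 * t]; dividing by [t ^ C] leaves
    [t ^ N <= l (a * t) * a.+1 ^ C]. An exponent [r < N] would then bound the power [N - r] of [t]
    by a constant. *)
Lemma growth_exponent_ge (l : nat -> nat) (N C a : nat) (r : R) :
  (forall t, t.+1 ^ (N + C) <= l (a * t) * (a * t).+1 ^ C)%N -> (0 < a)%N ->
  growth_exponents l r -> N%:R <= r.
Proof.
move=> lower a0 [c lc]; rewrite leNgt; apply/negP => rN.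
pose K : R := c * a%:R `^ r * (a.+1 ^ C)%:R.
have [t [t0 Kt]] := @powR_unbounded K (N%:R - r) ltac:(by rewrite subr_gt0).
have t0R : 0 < t%:R :> R by rewrite ltr0n.
have step : (t ^ N <= l (a * t) * a.+1 ^ C)%N.
  rewrite -(leq_pmul2r (m := t ^ C)) ?expn_gt0 ?t0 // -expnD -mulnA -expnMn.
  apply: leq_trans (leq_trans (lower t) _).
    by case: (N + C)%N => // s; rewrite leq_exp2r.
  rewrite leq_mul2l; apply/orP; right.
  elim: {lower lc K Kt} C => // s IH; rewrite !expnS leq_mul //; nia.
have := lc (a * t)%N; rewrite muln_gt0 a0 t0 => /(_ isT) ub.
suff : K >= t%:R `^ (N%:R - r) by rewrite leNgt Kt.
rewrite -(ler_pM2r (powR_gt0 r t0R)) -powRD; last by rewrite lt0r_neq0 ?implybT.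
rewrite subrK powR_mulrn ?ler0n // -natrX.
apply: le_trans (_ : ((l (a * t) * a.+1 ^ C)%N)%:R <= _); first by rewrite ler_nat.
rewrite natrM /K [X in _ <= X]mulrAC; apply: ler_wpM2r; first exact: ler0n.
by rewrite -mulrA -powRM ?ler0n // -natrM.
Qed.
End Asymptotics.

(** * The Gelfand-Kirillov dimension of T(W) *)

Theorem mainTheorem4 (k : fieldType) (hk : [pchar k] =i pred0)
    (n : nat) (W : vectType k) (hW : \dim {:W} = n) (R : realType) :
  has_GKdim (tensor_algebra W) ('C(n.+1, 2)%:R%:E : \bar R).
Proof.
subst n; split.
  exists (line_rep W), (line_incl W); split.
  - exact: line_finite_length.
  - exact: line_mono.
  - exact: line_generates.
move=> V f [lV lenV] _ gen_f.
have onto := generates_degree1 gen_f.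
have [d Vd] := has_length_bounded_degree lenV.
have {}Vd n (x : V n) : (d < n)%N -> x = 0 by move=> dn; apply: Vd dn I.
(* The image of the powers up to [m] lives in degrees at most [d * m], which bounds its chains and
   so gives it a length. *)
have /boolp.choice [l lP] : forall m, exists l, has_length (canon_image f m) l /\
    (l <= (d * m).+1 ^ 'C((\dim {:W}).+1, 2))%N.
  move=> m; have [c l cs cU|l Hl lB] := length_exists (U := canon_image f m)
      (B := ((d * m).+1 ^ 'C((\dim {:W}).+1, 2))%N); last by exists l.
  apply: leq_trans (sum_card_low _ _); apply: (tensor_chain_bound hk cs) => j x dj cx.
  exact: canon_image_high Vd dj (cU _ _ cx).
exists l; split=> [m|]; first exact: proj1 (lP m).
split=> [|r].
  (* The constant comes from [(d * m).+1 <= d.+1 * m], valid for [m >= 1]. *)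
  exists (d.+1 ^ 'C((\dim {:W}).+1, 2))%:R => m m0.
  rewrite powR_mulrn ?ler0n // -natrX -natrM ler_nat -expnMn.
  apply: leq_trans (proj2 (lP m)) _; case: 'C(_, 2) => // s.
  by rewrite leq_exp2r // mulSn addnC -addn1 leq_add2l.
(* The scale is the square of the dimension plus 1, so that it stays positive for [W = 0]; the two
   binomials add up to that square. *)
apply: (@growth_exponent_ge R l _ 'C(\dim {:W}, 2) (\dim {:W} * \dim {:W}).+1) => // t.
rewrite bin2D_square; apply: leq_trans (sum_card_full (m := (\dim {:W} * \dim {:W}).+1 * t) _) _.
  by rewrite leq_mul2r leqnSn orbT.
apply: (tensor_length_bound hk (proj1 (lP _))) => j x jm.
exact: canon_image_low.
Qed.
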